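(* Let $f:\mathbb{R}^d\to\mathbb{R}$ be twice differentiable, strongly convex with parameter $\mu>0$, with gradient Lipschitz continuous with parameter $L>0$ (so $\mu\|x-y\|\le\|\nabla f(x)-\nabla f(y)\|\le L\|x-y\|$ for all $x,y\in\mathbb{R}^d$). Let $x_*$ be its unique minimizer, and suppose that for some constant $M\ge 0$, $\|\nabla^2 f(x)-\nabla^2 f(x_* )\|\le M\|x-x_*\|$ for all $x\in\mathbb{R}^d$. Suppose that for some $\epsilon,\delta\in(0,\frac12)$ and $\rho\in(0,1)$, the initial point $x_0$ and the symmetric positive-definite initial Hessian approximation $B_0$ satisfy $$\frac{M}{\mu^{3/2}}\|\nabla^{2}f(x_* )^\frac{1}{2}(x_0 - x_* )\| \leq \epsilon, \qquad \|\nabla^{2}f(x_* )^{-\frac{1}{2}} (B_0 - \nabla^{2}f(x_* ))\nabla^{2}f(x_* )^{-\frac{1}{2}}\|_F \leq \delta.$$ (DFP) If $$\left[\frac{4(2\delta + 1)}{(1 - \epsilon)^2} + \frac{3 + \epsilon}{1 - \epsilon}\right]\frac{\epsilon}{1 - \rho} \leq \delta, \qquad \frac{\epsilon}{2} + 2\delta \leq (1 - 2\delta)\rho,$$ then the iterates $\{x_k\}$ of the DFP method (see context) converge to $x_*$ and satisfy, for all $k\ge1$, $$\frac{\|\nabla^{2}f(x_* )^\frac{1}{2}(x_k - x_* )\|}{\|\nabla^{2}f(x_* )^\frac{1}{2}(x_0 - x_* )\|} \leq \left(\frac{2\sqrt{2}\,\delta(1 + \rho)(1 + \frac{\epsilon}{2})\sqrt{k}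 + \frac{(1 + \rho)(1 + \frac{\epsilon}{2})\epsilon}{2(1 - \rho)}}{k}\right)^k,$$ $$\frac{f(x_k) - f(x_* )}{f(x_0) - f(x_* )} \leq \left(1 + \frac{\epsilon}{2}\right)^2\left(\frac{2\sqrt{2}\,\delta(1 + \rho)(1 + \frac{\epsilon}{2})\sqrt{k} + \frac{(1 + \rho)(1 + \frac{\epsilon}{2})\epsilon}{2(1 - \rho)}}{k}\right)^{2k}.$$ (BFGS) If $$\frac{(3 + \epsilon)\epsilon}{(1 - \epsilon)(1 - \rho)} \leq \delta, \qquad \frac{\epsilon}{2} + 2\delta \leq (1 - 2\delta)\rho,$$ then the iterates $\{x_k\}$ of the BFGS method (see context) converge to $x_*$ and satisfy, for all $k\ge1$, $$\frac{\|\nabla^{2}f(x_* )^\frac{1}{2}(x_k - x_* )\|}{\|\nabla^{2}f(x_* )^\frac{1}{2}(x_0 - x_* )\|} \leq \left(\frac{2\sqrt{2}\,\delta(1 + \rho)(1 + \frac{\epsilon}{2})\sqrt{\frac{1 + 2\delta}{1 - 2\delta}}\sqrt{k} + \frac{(1 + \rho)(1 + \frac{\epsilon}{2})\epsilon}{2(1 - \rho)}}{k}\right)^k,$$ $$\frac{f(x_k) - f(x_* )}{f(x_0) - f(x_* )} \leq \left(1 + \frac{\epsilon}{2}\right)^2\left(\frac{2\sqrt{2}\,\delta(1 + \rho)(1 + \frac{\epsilon}{2})\sqrt{\frac{1 + 2\delta}{1 - 2\delta}}\sqrt{k} + \frac{(1 + \rho)(1 + \frac{\epsilon}{2})\epsilon}{2(1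 - \rho)}}{k}\right)^{2k}.$$
   Context: DFP and BFGS methods (unit step size): given $x_0\in\mathbb{R}^d$ and a symmetric positive-definite $B_0\in\mathbb{R}^{d\times d}$, for $k=0,1,2,\dots$ set $x_{k+1}=x_k-B_k^{-1}\nabla f(x_k)$, $s_k=x_{k+1}-x_k$, $y_k=\nabla f(x_{k+1})-\nabla f(x_k)$, and $B_{k+1}=B^{DFP}_{k+1}$ (DFP method) or $B_{k+1}=B^{BFGS}_{k+1}$ (BFGS method), where $$B^{DFP}_{k+1} = \left(I-\frac{y_k s_k^\top}{y_k^\top s_k}\right) B_k \left(I-\frac{ s_ky_k^\top}{s_k^\top y_k}\right) +\frac{y_k y_k^\top}{y_k^\top s_k},\qquad B^{BFGS}_{k+1} = B_k - \frac{B_k s_k s_k^\top B_k}{s_k^\top B_k s_k} + \frac{y_k y_k^\top}{s_k^\top y_k}.$$ The algorithm terminates if $s_k=0$ (in which case $x_k=x_*$); it is assumed throughout that $s_k\ne0$ for all $k$. Then $s_k^\top y_k>0$ and all $B_k$ are symmetric positive-definite. $\|\cdot\|$ is the Euclidean norm of vectors and the induced 2-norm of matrices, $\|\cdot\|_F$ is the Frobenius norm, and $A^{1/2},A^{-1/2}$ denote the symmetric positive-definite square roots of $A$ and $A^{-1}$. *)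

(* Defs.v *)
From HB Require Import structures.
From mathcomp Require Export all_boot all_order all_algebra.
From mathcomp Require Export all_classical all_reals all_analysis.
Set Implicit Arguments.
Unset Strict Implicit.
Unset Printing Implicit Defensive.
Export Order.TTheory GRing.Theory Num.Theory.
Export numFieldNormedType.Exports.
Local Open Scope classical_set_scope.
Local Open Scope ring_scope.

Section EuclideanMatrices.
Variable R : realType.

Definition dot d (u v : 'cV[R]_d) : R := (u^T *m v) 0 0.

(* The library norm `|x| on matrices is the max norm, hence the norms below. *)
Definition enorm d (u : 'cV[R]_d) : R := Num.sqrt (dot u u).

Definition opnorm d (A : 'M[R]_d) : R :=
  sup [set enorm (A *m u) | u in [set u | enorm u <= 1]].

Definition frobenius d (A : 'M[R]_d) : R :=
  Num.sqrt (\sum_i \sum_j A i j ^+ 2).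

Definition symmetric_posdef d (A : 'M[R]_d) : Prop :=
  A^T = A /\ forall u : 'cV[R]_d, u != 0 -> 0 < dot u (A *m u).

(* The square root exists and is unique when A is symmetric positive definite;
   the default value 0 is only reached otherwise. *)
Definition sqrtmx d (A : 'M[R]_d) : 'M[R]_d :=
  xget 0 [set S | symmetric_posdef S /\ S *m S = A].

End EuclideanMatrices.

Section Calculus.
Variables (R : realType) (d : nat).
Implicit Types f : 'cV[R]_d -> R.

Definition gradient f (x : 'cV[R]_d) : 'cV[R]_d :=
  \col_i 'D_(delta_mx i 0) f x.

Definition hessian f (x : 'cV[R]_d) : 'M[R]_d :=
  \matrix_(i, j) 'D_(delta_mx j 0) (fun z => gradient f z i 0) x.

(* Frechet differentiability, twice; no continuity of the Hessian. *)
Definition twice_differentiable f : Prop :=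
  (forall x, differentiable f x) /\ (forall x, differentiable (gradient f) x).

Definition strongly_convex (mu : R) f : Prop :=
  forall (x y : 'cV[R]_d) (t : R), 0 <= t <= 1 ->
    f (t *: x + (1 - t) *: y) <=
      t * f x + (1 - t) * f y
      - mu / 2 * (t * (1 - t)) * enorm (x - y) ^+ 2.

Definition gradient_lipschitz (L : R) f : Prop :=
  forall x y : 'cV[R]_d,
    enorm (gradient f x - gradient f y) <= L * enorm (x - y).

End Calculus.

Section QuasiNewton.
Variables (R : realType) (d : nat).

(* Arguments: current matrix B_k, then s_k and y_k. *)
Definition DFP_update (B : 'M[R]_d) (s y : 'cV[R]_d) : 'M[R]_d :=
  (1%:M - (dot y s)^-1 *: (y *m s^T)) *m B *m
    (1%:M - (dot s y)^-1 *: (s *m y^T))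
  + (dot y s)^-1 *: (y *m y^T).

Definition BFGS_update (B : 'M[R]_d) (s y : 'cV[R]_d) : 'M[R]_d :=
  B - (dot s (B *m s))^-1 *: (B *m s *m s^T *m B)
  + (dot s y)^-1 *: (y *m y^T).

Definition quasi_newton_step
    (update : 'M[R]_d -> 'cV[R]_d -> 'cV[R]_d -> 'M[R]_d)
    (f : 'cV[R]_d -> R) (xB : 'cV[R]_d * 'M[R]_d) : 'cV[R]_d * 'M[R]_d :=
  let x := xB.1 in
  let B := xB.2 in
  let x' := x - invmx B *m gradient f x in
  (x', update B (x' - x) (gradient f x' - gradient f x)).

Definition quasi_newton_iterate update f (x0 : 'cV[R]_d) (B0 : 'M[R]_d)
    (k : nat) : 'cV[R]_d :=
  (iter k (quasi_newton_step update f) (x0, B0)).1.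

Definition DFP_iterate := quasi_newton_iterate DFP_update.
Definition BFGS_iterate := quasi_newton_iterate BFGS_update.

End QuasiNewton.

(* Main.v *)
Require Import Defs.
From mathcomp Require Import ring lra sesquilinear spectral complex.
Set Implicit Arguments.
Unset Strict Implicit.
Unset Printing Implicit Defensive.
Local Open Scope classical_set_scope.
Local Open Scope ring_scope.

(** Write H for the Hessian at the minimizer xs and T for the square root of
    its inverse.  Both updates commute with the linear change of variables
    r = T^-1 (x - xs), B |-> T B T, y |-> T y ([DFP_update_change],
    [BFGS_update_change]), so H may be replaced by the identity.  Then B is close
    to I, the gradient at r is r up to (kappa / 2) |r|^2, and the increment y of
    the gradient along a step s is s up to a relative error t that is at most
    kappa times the larger of the two distances to the minimizer, where
    kappa = M / mu^(3/2) ([normalized_gradient], [normalized_increment]).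

    If y were equal to s, an update would bring B closer to I in Frobenius norm,
    and the gain would be visible in the direction of the step: the square of
    the norm of E = B - I decreases by at least c q with
    q = |E s|^2 / |s|^2, where c = 1 for DFP ([DFP_exact_decrease]) and
    c = (1 - 2 delta) / (1 + 2 delta) for BFGS ([BFGS_exact_decrease]).  The true
    y differs from s by a relative error t and costs an additional W t
    ([DFP_update_bound], [BFGS_update_bound]).

    As long as |E| <= 2 delta, the step contracts the distance to the minimizer
    by rho ([linear_step]); hence the errors t form a geometric series, their
    total cost is at most delta, and |E| <= 2 delta is preserved ([invariant]).
    The same telescoping sum shows that the gains q are summable, with
    q_0 + ... + q_(k-1) <= 8 delta^2 / c.  Since the new error is
    (r - g) - E s, where g is the gradient, the contraction factor of step i is
    at most (1 + rho) sqrt q_i + (eps / 2) rho^i ([superlinear_step]), so it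
    tends to zero on average: bounding the product of k factors by the k-th
    power of their mean, and the sum of the sqrt q_i by Cauchy-Schwarz, gives
    the rate ([superlinear_rate]).  Function values follow because f - f(xs) is
    |r|^2 / 2 up to a relative error eps / 3.

    Two facts about the Hessian at xs are needed: it is symmetric
    ([hessian_symmetric]), although second derivatives are nowhere assumed to be
    continuous, and it has a positive definite square root ([sqrtmxP]), which is
    a real polynomial in it. *)

Lemma le_of_eq (R : realType) (x y : R) : x = y -> x <= y.
Proof. by move=> ->. Qed.

(** * Semi-inner products, Euclidean and Frobenius norms *)

(** Applied below to three forms: the Euclidean and Frobenius inner products, and
    the form u . B v of a positive semidefinite matrix B. *)
Section PositiveBilinearForms.
Variables (R : realType) (V : lmodType R) (q : V -> V -> R).
Hypotheses (qDl : forall u v w, q (u + v) w = q u w + q v w)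
  (qZl : forall a u v, q (a *: u) v = a * q u v)
  (qC : forall u v, q u v = q v u) (q_ge0 : forall u, 0 <= q u u).

(** When q v v = 0, the quadratic polynomial t |-> q (u - t v) (u - t v) is affine
    and nonnegative, hence constant. *)
Lemma form_cauchy_schwarz u v : q u v ^+ 2 <= q u u * q v v.
Proof.
have quad a b :
    q (a *: u + b *: v) (a *: u + b *: v)
    = a ^+ 2 * q u u + 2 * a * b * q u v + b ^+ 2 * q v v.
  rewrite qDl !qZl (qC u) (qC v (_ + _)) !qDl !qZl (qC v u); ring.
have := q_ge0 v; rewrite le_eqVlt => /orP[/eqP v0|v_gt0]; last first.
  have := q_ge0 (q v v *: u + (- q u v) *: v).
  rewrite quad => h; rewrite -subr_ge0 -(pmulr_lge0 _ v_gt0); lra.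
have [->|uv0] := eqVneq (q u v) 0; first by rewrite -v0 mulr0 expr0n.
have := q_ge0 (1 *: u + (- ((q u u + 1) / (2 * q u v))) *: v).
rewrite quad -v0 mulr0 addr0 => h.
suff : q u u - (q u u + 1) >= 0 by lra.
apply: le_trans h _; apply: le_of_eq.
by field.
Qed.

Lemma form_triangle u v :
  Num.sqrt (q (u + v) (u + v)) <= Num.sqrt (q u u) + Num.sqrt (q v v).
Proof.
rewrite -(ler_pXn2r (n := 2)) ?nnegrE ?addr_ge0 ?sqrtr_ge0 //.
rewrite sqr_sqrtr // sqrrD !sqr_sqrtr // -sqrtrM //.
rewrite qDl (qC u) (qC v (_ + _)) !qDl (qC v u).
have : q u v <= Num.sqrt (q u u * q v v).
  apply: le_trans (ler_norm _) _.
  by rewrite -sqrtr_sqr ler_sqrt ?form_cauchy_schwarz // mulr_ge0.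
lra.
Qed.

End PositiveBilinearForms.

Section EuclideanAlgebra.
Variables (R : realType) (d : nat).
Implicit Types (u v w : 'cV[R]_d) (A B : 'M[R]_d).

Lemma dotE u v : dot u v = \sum_i u i 0 * v i 0.
Proof. by rewrite /dot mxE; apply: eq_bigr => i _; rewrite mxE. Qed.

Lemma dotC u v : dot u v = dot v u.
Proof. by rewrite !dotE; apply: eq_bigr => i _; rewrite mulrC. Qed.

Lemma dotDl u v w : dot (u + v) w = dot u w + dot v w.
Proof. by rewrite /dot linearD mulmxDl mxE. Qed.

Lemma dotDr u v w : dot w (u + v) = dot w u + dot w v.
Proof. by rewrite !(dotC w) dotDl. Qed.

Lemma dotZl a u v : dot (a *: u) v = a * dot u v.
Proof. by rewrite /dot linearZ -scalemxAl mxE. Qed.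

Lemma dotZr a u v : dot v (a *: u) = a * dot v u.
Proof. by rewrite !(dotC v) dotZl. Qed.

Lemma dotNl u v : dot (- u) v = - dot u v.
Proof. by rewrite -scaleN1r dotZl mulN1r. Qed.

Lemma dotNr u v : dot v (- u) = - dot v u.
Proof. by rewrite !(dotC v) dotNl. Qed.

Lemma dotBl u v w : dot (u - v) w = dot u w - dot v w.
Proof. by rewrite dotDl dotNl. Qed.

Lemma dotBr u v w : dot w (u - v) = dot w u - dot w v.
Proof. by rewrite dotDr dotNr. Qed.

Lemma dot0l u : dot 0 u = 0.
Proof. by rewrite -(scale0r 0) dotZl mul0r. Qed.

Lemma dot_mulmxr A u v : dot u (A *m v) = dot (A^T *m u) v.
Proof. by rewrite /dot trmx_mul trmxK mulmxA. Qed.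

Lemma dot_ge0 u : 0 <= dot u u.
Proof. by rewrite dotE; apply: sumr_ge0 => i _; rewrite -expr2 sqr_ge0. Qed.

Lemma dot_eq0 u : (dot u u == 0) = (u == 0).
Proof.
apply/eqP/eqP => [|->]; last by rewrite dot0l.
rewrite dotE => /eqP; rewrite psumr_eq0 => [/allP h|i _]; last first.
  by rewrite -expr2 sqr_ge0.
apply/matrixP => i j; rewrite ord1 mxE.
by have := h i (mem_index_enum i); rewrite mulf_eq0 orbb => /eqP.
Qed.

Lemma enorm_ge0 u : 0 <= enorm u. Proof. exact: sqrtr_ge0. Qed.

Lemma sqr_enorm u : enorm u ^+ 2 = dot u u.
Proof. by rewrite sqr_sqrtr ?dot_ge0. Qed.

Lemma enorm_eq0 u : (enorm u == 0) = (u == 0).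
Proof. by rewrite -(sqrf_eq0 (enorm u)) sqr_enorm dot_eq0. Qed.

Lemma enorm_gt0 u : (0 < enorm u) = (u != 0).
Proof. by rewrite lt_def enorm_ge0 andbT enorm_eq0. Qed.

Lemma enorm0 : enorm (0 : 'cV[R]_d) = 0.
Proof. by apply/eqP; rewrite enorm_eq0. Qed.

Lemma enormZ a u : enorm (a *: u) = `|a| * enorm u.
Proof.
by rewrite /enorm dotZl dotZr mulrA -expr2 sqrtrM ?sqr_ge0 ?sqrtr_sqr.
Qed.

Lemma enormN u : enorm (- u) = enorm u.
Proof. by rewrite -scaleN1r enormZ normrN1 mul1r. Qed.

Lemma enormB u v : enorm (u - v) = enorm (v - u).
Proof. by rewrite -enormN opprB. Qed.

Lemma cauchy_schwarz u v : `|dot u v| <= enorm u * enorm v.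
Proof.
rewrite -(ler_pXn2r (n := 2)) ?nnegrE ?mulr_ge0 ?enorm_ge0 //.
rewrite exprMn !sqr_enorm real_normK ?num_real //.
exact: (form_cauchy_schwarz dotDl dotZl dotC dot_ge0).
Qed.

Lemma enormD u v : enorm (u + v) <= enorm u + enorm v.
Proof. exact: (form_triangle dotDl dotZl dotC dot_ge0). Qed.

Lemma enormB_le u v : enorm (u - v) <= enorm u + enorm v.
Proof. by rewrite -(enormN v) enormD. Qed.

(** Norm bounds are derived from bounds on the linear forms w |-> dot w u,
    because the mean value theorem only applies to scalar functions. *)
Lemma enorm_le_dual u c : 0 <= c ->
  (forall w, dot w u <= c * enorm w) -> enorm u <= c.
Proof.
move=> c0 h; have [u0|u0] := ltP 0 (enorm u).
  by rewrite -(ler_pM2r u0) -expr2 sqr_enorm h.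
exact: le_trans u0 c0.
Qed.

Lemma entry_le_enorm u i : `|u i 0| <= enorm u.
Proof.
rewrite -sqrtr_sqr ler_sqrt ?dot_ge0 // dotE (bigD1 i) //= -expr2.
by rewrite lerDl; apply: sumr_ge0 => j _; rewrite -expr2 sqr_ge0.
Qed.

(** The inner product whose norm is the Frobenius norm. *)
Definition fdot A B : R := \tr (A^T *m B).

Lemma fdotDl A B C : fdot (A + B) C = fdot A C + fdot B C.
Proof. by rewrite /fdot linearD mulmxDl linearD. Qed.

Lemma fdotZl a A B : fdot (a *: A) B = a * fdot A B.
Proof. by rewrite /fdot linearZ -scalemxAl linearZ. Qed.

Lemma fdotC A B : fdot A B = fdot B A.
Proof. by rewrite /fdot -mxtrace_tr trmx_mul trmxK. Qed.

Lemma fdotDr A B C : fdot C (A + B) = fdot C A + fdot C B.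
Proof. by rewrite !(fdotC C) fdotDl. Qed.

Lemma fdotZr a A B : fdot B (a *: A) = a * fdot B A.
Proof. by rewrite !(fdotC B) fdotZl. Qed.

Lemma fdotNl A B : fdot (- A) B = - fdot A B.
Proof. by rewrite -scaleN1r fdotZl mulN1r. Qed.

Lemma fdotNr A B : fdot B (- A) = - fdot B A.
Proof. by rewrite !(fdotC B) fdotNl. Qed.

Lemma fdot_outer A u v : fdot A (u *m v^T) = dot u (A *m v).
Proof.
by rewrite dotC /fdot mulmxA mxtrace_mulC mulmxA /dot -trmx_mul /mxtrace big_ord1.
Qed.

Lemma mulmx_outer u v w : u *m v^T *m w = dot v w *: u.
Proof.
rewrite -mulmxA [v^T *m w]mx11_scalar -/(dot v w).
by rewrite mul_mx_scalar.
Qed.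

Lemma fdot_frobenius A : fdot A A = \sum_i \sum_j A i j ^+ 2.
Proof.
rewrite /fdot /mxtrace exchange_big /=; apply: eq_bigr => i _.
by rewrite mxE; apply: eq_bigr => j _; rewrite mxE.
Qed.

Lemma frobeniusE A : frobenius A = Num.sqrt (fdot A A).
Proof. by rewrite fdot_frobenius. Qed.

Lemma fdot_ge0 A : 0 <= fdot A A.
Proof.
by rewrite fdot_frobenius; do 2! apply: sumr_ge0 => ? _; exact: sqr_ge0.
Qed.

Lemma sqr_frobenius A : frobenius A ^+ 2 = fdot A A.
Proof. by rewrite frobeniusE sqr_sqrtr ?fdot_ge0. Qed.

Lemma frobenius_ge0 A : 0 <= frobenius A. Proof. exact: sqrtr_ge0. Qed.

Lemma frobeniusD A B : frobenius (A + B) <= frobenius A + frobenius B.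
Proof. by rewrite !frobeniusE (form_triangle fdotDl fdotZl fdotC fdot_ge0). Qed.

Lemma frobeniusZ a A : frobenius (a *: A) = `|a| * frobenius A.
Proof.
by rewrite !frobeniusE fdotZl fdotZr mulrA -expr2 sqrtrM ?sqr_ge0 ?sqrtr_sqr.
Qed.

Lemma frobenius_outer u v : frobenius (u *m v^T) = enorm u * enorm v.
Proof.
rewrite frobeniusE fdot_outer mulmx_outer dotZr mulrC sqrtrM ?dot_ge0 //.
Qed.

(** The Frobenius norm dominates the operator norm: test A against the
    rank-one matrix (A u) u^T. *)
Lemma enorm_mulmx A u : enorm (A *m u) <= frobenius A * enorm u.
Proof.
apply: enorm_le_dual => [|w]; first by rewrite mulr_ge0 ?frobenius_ge0 ?enorm_ge0.
rewrite -fdot_outer; apply: le_trans (ler_norm _) _.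
rewrite -(ler_pXn2r (n := 2)) ?nnegrE ?mulr_ge0 ?frobenius_ge0 ?enorm_ge0 //.
rewrite real_normK ?num_real //.
apply: le_trans (form_cauchy_schwarz fdotDl fdotZl fdotC fdot_ge0 _ _) _.
rewrite -!sqr_frobenius frobenius_outer le_eqVlt; apply/orP; left; apply/eqP; ring.
Qed.

Lemma enorm_mulmx_opnorm A u : enorm (A *m u) <= opnorm A * enorm u.
Proof.
have [->|u0] := eqVneq u 0; first by rewrite mulmx0 enorm0 mulr0.
have nu : 0 < enorm u by rewrite enorm_gt0.
rewrite -ler_pdivrMr // mulrC -[(enorm u)^-1]gtr0_norm ?invr_gt0 //.
rewrite -enormZ scalemxAr; apply: ub_le_sup.
  exists (frobenius A) => _ [v /= v1 <-]; apply: le_trans (enorm_mulmx _ _) _.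
  by rewrite -[leRHS]mulr1 ler_wpM2l ?frobenius_ge0.
exists ((enorm u)^-1 *: u) => //=.
by rewrite enormZ gtr0_norm ?invr_gt0 // mulVf ?gt_eqF.
Qed.

Lemma injective_unitmx A :
  (forall u : 'cV[R]_d, A *m u = 0 -> u = 0) -> A \in unitmx.
Proof.
move=> Ainj; rewrite -unitmx_tr -row_free_unit -kermx_eq0.
apply/eqP/row_matrixP => i; rewrite row0.
apply: trmx_inj; rewrite trmx0; apply: Ainj.
apply: trmx_inj; rewrite trmx_mul trmxK trmx0.
by apply/sub_kermxP; rewrite row_sub.
Qed.

End EuclideanAlgebra.

(** * Square roots of positive definite matrices *)

Lemma interpolation (F : fieldType) (g : F -> F) (s : seq F) :
  exists p : {poly F}, {in s, forall x, p.[x] = g x}.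
Proof.
elim: s => [|a s [p ps]]; first by exists 0.
have [a_s|a_s] := boolP (a \in s).
  by exists p => x; rewrite inE => /predU1P[->|]; apply: ps.
pose w := \prod_(z <- s) ('X - z%:P).
have w0 : w.[a] != 0 by rewrite -rootE root_prod_XsubC.
exists (p + ((g a - p.[a]) / w.[a]) *: w) => x.
(* The added term vanishes on s, so it only corrects the value at a. *)
rewrite inE hornerD hornerZ => /predU1P[->|xs]; first by field.
have /rootP -> : root w x by rewrite root_prod_XsubC.
by rewrite mulr0 addr0 ps.
Qed.

Lemma horner_mx_similar_diag (F : fieldType) n (P : 'M[F]_n.+1) (l : 'rV_n.+1)
    (p : {poly F}) : P \in unitmx ->
  horner_mx (invmx P *m diag_mx l *m P) p
  = invmx P *m diag_mx (map_mx (horner p) l) *m P.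
Proof. by move=> Pu; rewrite horner_mx_uconjC // horner_mx_diag. Qed.

Section SquareRoot.
Variable R : realType.

Lemma symmetric_posdef_unit d (A : 'M[R]_d) :
  symmetric_posdef A -> A \in unitmx.
Proof.
move=> [_ Apos]; apply: injective_unitmx => u Au0.
apply/eqP/negPn/negP => /Apos.
by rewrite Au0 dotC dot0l ltxx.
Qed.

Lemma symmetric_posdef_inv d (A : 'M[R]_d) :
  symmetric_posdef A -> symmetric_posdef (invmx A).
Proof.
move=> As; have Au := symmetric_posdef_unit As; case: As => At Apos.
have it : (invmx A)^T = invmx A by rewrite trmx_inv At.
split=> // u u0; have v0 : invmx A *m u != 0.
  by apply: contraNneq u0 => h; rewrite -(mulKVmx Au u) h mulmx0.
by have := Apos _ v0; rewrite mulmxA mulmxV // mul1mx dotC.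
Qed.

Lemma eigenvalue_posdef_gt0 d (A : 'M[R]_d) (l : R) :
  symmetric_posdef A -> eigenvalue A l -> 0 < l.
Proof.
move=> [At Apos] /eigenvalueP[v vA v0].
have vt0 : v^T != 0 by rewrite -(inj_eq (@trmx_inj _ _ _)) trmxK trmx0.
have := Apos _ vt0; rewrite -{1}At -trmx_mul vA linearZ dotZr.
have : 0 < dot v^T v^T by rewrite lt_def dot_eq0 vt0 dot_ge0.
by move=> h; rewrite pmulr_lgt0.
Qed.

(** The complexified matrix is unitarily diagonal with positive real
    eigenvalues, so a real polynomial interpolating the fourth root on the
    spectrum has a fourth power that fixes the matrix. *)
Lemma posdef_fourth_root n (A : 'M[R]_n.+1) :
  symmetric_posdef A -> exists q : {poly R}, horner_mx A q ^+ 4 = A.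
Proof.
move=> As; have [At _] := As.
pose f := real_complex R; pose A' := map_mx f A.
have A'herm : A' \is hermsymmx.
  apply: realsym_hermsym.
    apply/is_hermitianmxP; rewrite expr0 scale1r.
    by apply/matrixP => i j; rewrite !mxE -{1}At mxE.
  apply/mxOverP => i j; rewrite mxE; apply/complex_realP; by exists (A i j).
have spR := hermitian_spectral_diag_real A'herm.
have /orthomx_spectralP := hermitian_normalmx A'herm.
have := spectral_unit A'.
set P := spectralmx A'; set sp := spectral_diag A' => Pu A'E.
pose l := map_mx (@Re R) sp.
have spE : sp = map_mx f l.
  apply/matrixP => i j; rewrite !mxE.
  by have /mxOverP/(_ i j)/RRe_real := spR.
have l_gt0 i : 0 < l 0 i.
  apply: (eigenvalue_posdef_gt0 As); rewrite eigenvalue_root_char.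
  rewrite -(fmorph_root f) map_char_poly -/A' -eigenvalue_root_char.
  have -> // : eigenvalue A' (f (l 0 i)).
  have -> : f (l 0 i) = sp 0 i by rewrite spE [RHS]mxE.
  apply/eigenvalueP; exists (row i P).
    by rewrite -row_mul A'E !mulmxA mulmxV // mul1mx row_mul row_diag_mx
      -scalemxAl -rowE.
  apply/eqP => r0; have := row_mul i P (invmx P).
  rewrite r0 mul0mx mulmxV // => /rowP/(_ i)/eqP.
  by rewrite !mxE eqxx oner_eq0.
have [q qE] := interpolation (fun x => Num.sqrt (Num.sqrt x))
  [seq l 0 i | i : 'I_n.+1].
exists q; apply: (@map_mx_inj _ _ f).
rewrite -rmorphXn /= map_horner_mx -/A'.
have := horner_mx_similar_diag sp (map_poly f (q ^+ 4)) Pu.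
rewrite -A'E => ->; suff -> : map_mx (horner (map_poly f (q ^+ 4))) sp = sp.
  by [].
apply/rowP => i; rewrite !mxE spE mxE horner_map; congr f.
rewrite horner_exp qE ?map_f ?mem_enum //.
by rewrite (exprM _ 2 2) !sqr_sqrtr ?sqrtr_ge0 ?ltW.
Qed.

(** With Q = q(A) and Q ^ 4 = A, the matrix Q ^ 2 is a square root of A; it is
    positive because u . Q ^ 2 u = |Q u|^2.  A fourth root is used so that
    positivity comes for free. *)
Lemma sqrtmx_exists d (A : 'M[R]_d) : symmetric_posdef A ->
  exists S, symmetric_posdef S /\ S *m S = A.
Proof.
case: d A => [|n] A As.
  have e (X Y : 'M[R]_0) : X = Y by apply/matrixP => -[].
  exists A; split=> //; exact: e.
have [q qA] := posdef_fourth_root As.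
set Q := horner_mx A q in qA.
have Qt : Q^T = Q.
  rewrite /Q; have [At _] := As.
  elim/poly_ind: q {qA Q} => [|p c IH]; first by rewrite rmorph0 trmx0.
  rewrite rmorphD rmorphM /= horner_mx_X horner_mx_C linearD /= tr_scalar_mx.
  rewrite -[_ * A]/(_ *m A) trmx_mul IH At; congr (_ + _).
  exact/esym/comm_horner_mx.
have QQt : (Q *m Q)^T = Q *m Q by rewrite trmx_mul Qt.
exists (Q *m Q); split; last by rewrite -[RHS]qA (exprM _ 2 2) !expr2.
split=> // u u0; rewrite -mulmxA dot_mulmxr Qt lt_def dot_eq0 dot_ge0 andbT.
have Qu : Q \in unitmx.
  by rewrite -[_ \in _]/(Q \is a GRing.unit) -(unitrX_pos _ (n := 4)) // qA
    -[_ \in _]/(A \in unitmx) symmetric_posdef_unit.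
by apply: contraNneq u0 => h; rewrite -(mulKmx Qu u) h mulmx0.
Qed.

Lemma sqrtmxP d (A : 'M[R]_d) : symmetric_posdef A ->
  symmetric_posdef (sqrtmx A) /\ sqrtmx A *m sqrtmx A = A.
Proof.
by move=> /sqrtmx_exists[S hS]; rewrite /sqrtmx; case: xgetP => [? -> //|/(_ S)].
Qed.

End SquareRoot.

(** * Mean value inequalities *)

(** Integrating a pointwise bound on a derivative, the derivative being allowed
    to be discontinuous. *)
Lemma increment_le (R : realType) (phi dphi : R -> R) (a b c : R) (n : nat) :
  (forall s : R, is_derive s 1 phi (dphi s)) ->
  (forall s : R, 0 <= s <= 1 -> dphi s - (a + b * s) <= c * s ^+ n) ->
  phi 1 - phi 0 - (a + b / 2) <= c / n.+1%:R.
Proof.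
move=> dphiE dphi_le.
pose psi : R -> R := phi - (a *: (@idfun R : R -> R)
  + (b / 2) *: ((@idfun R : R -> R) ^+ 2))
  - (c / n.+1%:R) *: ((@idfun R : R -> R) ^+ n.+1).
have dX k (s : R) := @is_deriveX R R idfun k s 1 1 (is_derive_id s 1).
have dpsi (s : R) : is_derive s 1 psi (dphi s - (a + b * s) - c * s ^+ n).
  apply: is_derive_eq (is_deriveB (is_deriveB (dphiE s) (is_deriveD
    (is_deriveZ a (is_derive_id s 1)) (is_deriveZ (b / 2) (dX 2%N s))))
    (is_deriveZ (c / n.+1%:R) (dX n.+1 s))) _.
  rewrite /GRing.scale /= !mulr1 (mulrA (c / _)) divfK ?pnatr_eq0 // expr1.
  by rewrite (mulrA (b / 2)) divfK ?pnatr_eq0.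
have [s s01] : exists2 s, s \in `[(0:R), 1]%R &
    psi 1 - psi 0 = (dphi s - (a + b * s) - c * s ^+ n) * (1 - 0).
  apply: MVT_segment => //; apply: derivable_within_continuous => s _.
  exact: ex_derive.
rewrite subr0 mulr1 => e; move: s01; rewrite in_itv /= => /dphi_le.
rewrite -subr_le0 -e /psi !fctE /= /GRing.scale /= !expr1n !expr0n /= !mulr1.
move: (c / _) => k; lra.
Qed.

Lemma abs_increment_le (R : realType) (phi dphi : R -> R) (a b c : R) (n : nat) :
  (forall s : R, is_derive s 1 phi (dphi s)) ->
  (forall s : R, 0 <= s <= 1 -> `|dphi s - (a + b * s)| <= c * s ^+ n) ->
  `|phi 1 - phi 0 - (a + b / 2)| <= c / n.+1%:R.
Proof.
move=> d h; rewrite ler_norml; apply/andP; split; last first.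
  by apply: (increment_le d) => s /h; apply: le_trans; exact: ler_norm.
have : (- phi) 1 - (- phi) 0 - (- a + (- b) / 2) <= c / n.+1%:R.
  apply: (increment_le (dphi := fun s => - dphi s)) => s /h {}h.
  apply: le_trans h; rewrite -normrN; apply: le_trans (ler_norm _).
  by apply: le_of_eq; ring.
rewrite !fctE; move: (c / _) => k; lra.
Qed.

Lemma abs_increment_const (R : realType) (phi dphi : R -> R) (a c : R) (n : nat) :
  (forall s : R, is_derive s 1 phi (dphi s)) ->
  (forall s : R, 0 <= s <= 1 -> `|dphi s - a| <= c * s ^+ n) ->
  `|phi 1 - phi 0 - a| <= c / n.+1%:R.
Proof.
move=> d h; have := @abs_increment_le _ _ _ a 0 c n d.
by rewrite mul0r addr0; apply => s /h; rewrite mul0r addr0.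
Qed.

Section Calculus.
Variables (R : realType) (d : nat).
Implicit Types (p v w : 'cV[R]_d).

Lemma derive_coord_sum (g : 'cV[R]_d -> R) p v : differentiable g p ->
  'D_v g p = \sum_i 'D_(delta_mx i 0) g p * v i 0.
Proof.
move=> dg; rewrite deriveE // [v in LHS]matrix_sum_delta.
rewrite linear_sum; apply: eq_bigr => i _; rewrite big_ord1 linearZ.
by rewrite deriveE // mulrC.
Qed.

(** The difference quotient of the restriction to a line is the directional
    difference quotient. *)
Lemma is_derive_line (g : 'cV[R]_d -> R) p v (s : R) :
  differentiable g (p + s *: v) ->
  is_derive s 1 (fun t => g (p + t *: v)) ('D_v g (p + s *: v)).
Proof.
move=> /(@diff_derivable _ _ _ _ _ v) dg.
have e : (fun h : R => h^-1 *:
     (((fun t => g (p + t *: v)) \o shift s) (h *: 1) - g (p + s *: v)))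
   = (fun h => h^-1 *: ((g \o shift (p + s *: v)) (h *: v) - g (p + s *: v))).
  apply/funext => h /=; congr (_ *: (g _ - _)).
  by rewrite /GRing.scale /= mulr1 -/(_ *: v) scalerDl addrCA.
by split; rewrite /derivable /derive e.
Qed.

Variable f : 'cV[R]_d -> R.
Hypothesis f2 : twice_differentiable f.

Lemma is_derive_fun_line p v (s : R) :
  is_derive s 1 (fun t => f (p + t *: v)) (dot (gradient f (p + s *: v)) v).
Proof.
have df := f2.1 (p + s *: v).
apply: is_derive_eq (is_derive_line df) _.
by rewrite derive_coord_sum // dotE; apply: eq_bigr => i _; rewrite mxE.
Qed.

Lemma is_derive_gradient_line w p v (s : R) :
  is_derive s 1 (fun t => dot w (gradient f (p + t *: v)))
    (dot w (hessian f (p + s *: v) *m v)).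
Proof.
have dg i : differentiable (fun z => gradient f z i 0) (p + s *: v).
  apply: (@differentiable_comp _ _ _ _ (gradient f) (fun N : 'cV[R]_d => N i 0)).
    exact: f2.2.
  exact: differentiable_coord.
have -> : (fun t => dot w (gradient f (p + t *: v)))
   = \sum_i (w i 0 *: (fun t => gradient f (p + t *: v) i 0)).
  by apply/funext => t; rewrite dotE fct_sumE.
apply: is_derive_eq.
  apply: is_derive_sum => i; apply: is_deriveZ.
  exact: (is_derive_line (dg i)).
rewrite dotE; apply: eq_bigr => i _; rewrite derive_coord_sum // [in RHS]mxE.
by congr (_ * _); apply: eq_bigr => j _; rewrite mxE.
Qed.

End Calculus.

(** * Expansions at the minimizer *)

Lemma le0_of_le_linear (R : realType) (x K : R) :
  (forall t, 0 < t -> x <= t * K) -> x <= 0.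
Proof.
move=> h; rewrite leNgt; apply/negP => x0.
have [K0|K0] := leP K 0.
  have := h 1 ltr01; rewrite mul1r; lra.
have := h (x / (2 * K)); rewrite divr_gt0 ?mulr_gt0 // => /(_ isT).
have -> : x / (2 * K) * K = x / 2 by field; rewrite gt_eqF.
lra.
Qed.

Section TaylorAtMinimizer.
Variables (R : realType) (d : nat) (f : 'cV[R]_d -> R) (xs : 'cV[R]_d) (M : R).
Hypothesis f2 : twice_differentiable f.
Hypothesis xs_min : forall x, f xs <= f x.
Hypothesis M_ge0 : 0 <= M.
Hypothesis hess_lip :
  forall x, opnorm (hessian f x - hessian f xs) <= M * enorm (x - xs).
Local Notation H := (hessian f xs).
Implicit Types (x y v w p q : 'cV[R]_d).

Lemma gradient_minimizer : gradient f xs = 0.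
Proof.
apply/eqP; rewrite -dot_eq0; apply/eqP.
set g := gradient f xs.
have d0 : is_derive (0 : R) 1 (fun t => f (xs + t *: g)) 0.
  apply: (@derive1_at_min R _ (-1) 1) => //.
  - move=> t _; have h := is_derive_fun_line f2 xs g t; exact: ex_derive.
  - by rewrite in_itv /= ltrN10 ltr01.
  - by move=> t _; rewrite scale0r addr0.
have h := is_derive_fun_line f2 xs g 0.
rewrite scale0r addr0 -/g in h.
by rewrite -[LHS](@derive_val _ _ _ _ _ _ _ h) (@derive_val _ _ _ _ _ _ _ d0).
Qed.

Lemma hessian_bilinear_lip x v w :
  `|dot w ((hessian f x - H) *m v)| <= M * enorm (x - xs) * enorm v * enorm w.
Proof.
apply: le_trans (cauchy_schwarz _ _) _; rewrite mulrC ler_wpM2r ?enorm_ge0 //.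
apply: le_trans (enorm_mulmx_opnorm _ _) _.
by rewrite ler_wpM2r ?enorm_ge0.
Qed.

Lemma gradient_increment x v w c :
  (forall s : R, 0 <= s <= 1 -> enorm (x + s *: v - xs) <= c) ->
  `|dot w (gradient f (x + v) - gradient f x - H *m v)|
    <= M * c * enorm v * enorm w.
Proof.
move=> hc.
have := @abs_increment_const R _ _ (dot w (H *m v))
  (M * c * enorm v * enorm w) 0 (is_derive_gradient_line f2 w x v).
rewrite scale1r scale0r (addr0 x) divr1 !dotBr; apply => s s01.

rewrite -dotBr -mulmxBl expr0 mulr1.
apply: le_trans (hessian_bilinear_lip _ _ _) _.
by rewrite !ler_wpM2r ?enorm_ge0 // ler_wpM2l // hc.
Qed.

Lemma gradient_at_minimizer v w :
  `|dot w (gradient f (xs + v) - H *m v)| <= M / 2 * enorm v ^+ 2 * enorm w.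
Proof.
have := @abs_increment_const R _ _ (dot w (H *m v))
  (M * enorm v ^+ 2 * enorm w) 1 (is_derive_gradient_line f2 w xs v).
rewrite scale1r scale0r (addr0 xs) gradient_minimizer !dotBr (dotC w 0).
rewrite dot0l subr0.
have -> : M * enorm v ^+ 2 * enorm w / 2 = M / 2 * enorm v ^+ 2 * enorm w by ring.
apply => s /andP[s0 s1].
rewrite -dotBr -mulmxBl expr1.
apply: le_trans (hessian_bilinear_lip _ _ _) _.
rewrite addrAC subrr add0r enormZ ger0_norm //.
by apply: le_of_eq; ring.
Qed.

Lemma fun_at_minimizer v :
  `|f (xs + v) - f xs - dot v (H *m v) / 2| <= M / 6 * enorm v ^+ 3.
Proof.
have := @abs_increment_le R _ _ 0 (dot v (H *m v)) (M / 2 * enorm v ^+ 3) 2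
  (is_derive_fun_line f2 xs v).
rewrite scale1r scale0r (addr0 xs) (add0r (dot v (H *m v) / 2)).
have -> : M / 2 * enorm v ^+ 3 / 3 = M / 6 * enorm v ^+ 3 by field.
apply => s /andP[s0 s1]; rewrite add0r.
have := gradient_at_minimizer (s *: v) v.
rewrite dotBr -scalemxAr dotZr enormZ (ger0_norm s0) dotC (mulrC s).
move=> h; apply: le_trans h _.
by apply: le_of_eq; ring.
Qed.

(** The same expansion based at xs + p instead of xs.  Its first order term uses
    H p in place of the gradient, so it sees the order of the arguments of the
    second derivative, unlike the expansion at xs. *)
Lemma fun_increment p v c :
  (forall s : R, 0 <= s <= 1 -> enorm (p + s *: v) <= c) ->
  `|f (xs + p + v) - f (xs + p) - (dot v (H *m p) + dot v (H *m v) / 2)|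
    <= M / 2 * c ^+ 2 * enorm v.
Proof.
move=> hc.
have := @abs_increment_le R _ _ (dot v (H *m p)) (dot v (H *m v))
  (M / 2 * c ^+ 2 * enorm v) 0 (is_derive_fun_line f2 (xs + p) v).
rewrite scale1r scale0r (addr0 (xs + p)) divr1; apply => s s01.
have := gradient_at_minimizer (p + s *: v) v.
rewrite dotBr mulmxDr -scalemxAr dotDr dotZr addrA dotC (mulrC s) expr0 mulr1.
move=> h; apply: le_trans h _; rewrite ler_wpM2r ?enorm_ge0 //.
rewrite ler_wpM2l ?divr_ge0 //.
by rewrite ler_pXn2r ?nnegrE ?enorm_ge0 ?hc // (le_trans (enorm_ge0 _) (hc s s01)).
Qed.

(** Symmetry of the second derivative without continuity: f is quadratic up to
    a cubic error, and integrating its gradient from xs + t p to xs + t q would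
    otherwise produce a term in t ^ 2 from the antisymmetric part. *)
Lemma hessian_symmetric_form p q : dot p (H *m q) = dot q (H *m p).
Proof.
suff le p' q' : dot p' (H *m q') - dot q' (H *m p') <= 0.
  have := le p q; have := le q p; lra.
move: p' q' => {}q {}p.
pose c := enorm p + enorm (q - p).
have c0 : 0 <= c by rewrite addr_ge0 ?enorm_ge0.
(* K collects the cubic error terms of the three expansions below. *)
pose K := M * c ^+ 2 * enorm (q - p) + M / 3 * enorm q ^+ 3 + M / 3 * enorm p ^+ 3.
apply: (@le0_of_le_linear _ _ K) => t t0.
have hq := fun_at_minimizer (t *: q).
have hp := fun_at_minimizer (t *: p).
have hpq : `|f (xs + t *: p + t *: (q - p)) - f (xs + t *: p)
   - (dot (t *: (q - p)) (H *m (t *: p)) +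
      dot (t *: (q - p)) (H *m (t *: (q - p))) / 2)|
   <= M / 2 * (t * c) ^+ 2 * enorm (t *: (q - p)).
  apply: fun_increment => s /andP[s0 s1].
  rewrite scalerA (mulrC s) -scalerA -scalerDr enormZ gtr0_norm // ler_pM2l //.
  apply: le_trans (enormD _ _) _; rewrite lerD2l enormZ ger0_norm //.
  by rewrite ler_piMl ?enorm_ge0.
have e : xs + t *: p + t *: (q - p) = xs + t *: q.
  by rewrite -addrA -scalerDr subrKC.
rewrite e in hpq; move: hp hq hpq.
rewrite !enormZ (gtr0_norm t0) -!scalemxAr !dotZl !dotZr mulmxBr !dotBl !dotBr.
rewrite !ler_norml => /andP[p1 p2] /andP[q1 q2] /andP[r1 r2].
have t2 : 0 < t ^+ 2 by rewrite exprn_gt0.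
rewrite -(ler_pM2l t2).
rewrite /K; lra.
Qed.

Lemma hessian_symmetric : H^T = H.
Proof.
apply/matrixP => i j; rewrite mxE.
have := hessian_symmetric_form (delta_mx i 0) (delta_mx j 0).
rewrite -!colE !dotE (bigD1 i) //= [X in _ + X]big1 => [|k ki]; last first.
  by rewrite !mxE (negbTE ki) mul0r.
rewrite (bigD1 j) //= [X in _ = _ + X]big1 => [|k kj]; last first.
  by rewrite !mxE (negbTE kj) mul0r.
by rewrite !mxE !eqxx !mul1r !addr0 => ->.
Qed.

(** Strong convexity at the midpoint of xs + t v and xs - t v, where the first
    order terms of the expansion cancel. *)
Lemma hessian_strongly_convex mu v :
  strongly_convex mu f -> mu * dot v v <= dot v (H *m v).
Proof.
move=> fmu; rewrite -subr_le0.
apply: (@le0_of_le_linear _ _ (M / 3 * enorm v ^+ 3)) => t t0.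
have h1 := fun_at_minimizer (t *: v).
have h2 := fun_at_minimizer (t *: (- v)).
have := fmu (xs + t *: v) (xs + t *: (- v)) 2^-1.
have -> : 2^-1 *: (xs + t *: v) + (1 - 2^-1) *: (xs + t *: - v) = xs.
  have -> : 1 - 2^-1 = 2^-1 :> R by field.
  rewrite -scalerDr scalerN addrACA subrr addr0 -mulr2n -(scaler_nat 2 xs) scalerA.
  by rewrite mulVf ?scale1r // pnatr_eq0.
have -> : xs + t *: v - (xs + t *: - v) = (2 * t) *: v.
  by rewrite scalerN opprD opprK addrACA subrr add0r -scalerDl -mulr2n mulr_natl.
have -> : 0 <= (2^-1 : R) <= 1 by apply/andP; split; lra.
move=> /(_ isT).
move: h1 h2; rewrite !enormZ !enormN normrM normr_nat (gtr0_norm t0) -(sqr_enorm v).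
rewrite -!scalemxAr !dotZl !dotZr mulmxN !dotNl !dotNr.
rewrite !ler_norml => /andP[p1 p2] /andP[q1 q2] r.
have t2 : 0 < t ^+ 2 by rewrite exprn_gt0.
rewrite -(ler_pM2l t2); lra.
Qed.

Lemma hessian_posdef mu : 0 < mu -> strongly_convex mu f -> symmetric_posdef H.
Proof.
move=> mu0 fmu; split=> [|u u0]; first exact: hessian_symmetric.
apply: lt_le_trans (hessian_strongly_convex u fmu).
by rewrite mulr_gt0 // lt_def dot_eq0 u0 dot_ge0.
Qed.

End TaylorAtMinimizer.

(** * One quasi-Newton update near the identity *)

Section UpdateEstimates.
Variables (R : realType) (d : nat).
Implicit Types (B E : 'M[R]_d) (s y u v : 'cV[R]_d).

(** Turns a decrease of the squared norm into a decrease of the norm: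
    sqrt (a^2 - q) <= a - q / (2 a) <= a - q / (2 D). *)
Lemma le_sub_of_sqr_le (x a q D : R) : 0 <= a <= D -> 0 < D -> 0 <= q ->
  x ^+ 2 <= a ^+ 2 - q -> x <= a - q / (2 * D).
Proof.
move=> /andP[a0 aD] D0 q0 h.
have qa : q <= a ^+ 2 by have := sqr_ge0 x; lra.
have D2 : 0 < 2 * D by rewrite mulr_gt0.
have r0 : 0 <= a - q / (2 * D).
  rewrite subr_ge0 ler_pdivrMr //; apply: le_trans qa _.
  rewrite expr2 ler_wpM2l //; lra.
apply: le_trans (ler_norm x) _.
rewrite -(ler_pXn2r (n := 2)) ?nnegrE ?normr_ge0 // real_normK ?num_real //.
apply: le_trans h _.
have -> : (a - q / (2 * D)) ^+ 2 = a ^+ 2 - q * (a / D) + (q / (2 * D)) ^+ 2.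
  by field; rewrite gt_eqF.
have : q * (a / D) <= q by rewrite ler_piMr // ler_pdivrMr // mul1r.
have := sqr_ge0 (q / (2 * D)); lra.
Qed.

Lemma outerE u v i j : (u *m v^T) i j = u i 0 * v j 0.
Proof. by rewrite mxE big_ord1 mxE. Qed.

Lemma form_near_identity B u e : frobenius (B - 1%:M) <= e ->
  (1 - e) * dot u u <= dot u (B *m u) <= (1 + e) * dot u u.
Proof.
move=> he; have : `|dot u ((B - 1%:M) *m u)| <= e * dot u u.
  apply: le_trans (cauchy_schwarz _ _) _.
  rewrite -sqr_enorm expr2 mulrA [leRHS]mulrC ler_wpM2l ?enorm_ge0 //.
  apply: le_trans (enorm_mulmx _ _) _.
  by rewrite ler_wpM2r ?enorm_ge0.
rewrite mulmxBl mul1mx dotBr ler_norml => /andP[h1 h2]; apply/andP; split; lra.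
Qed.

Lemma enorm_near_identity B u e : frobenius (B - 1%:M) <= e ->
  enorm (B *m u) <= (1 + e) * enorm u.
Proof.
move=> he; have -> : B *m u = u + (B - 1%:M) *m u.
  by rewrite mulmxBl mul1mx subrKC.
apply: le_trans (enormD _ _) _; rewrite mulrDl mul1r lerD2l.
by apply: le_trans (enorm_mulmx _ _) _; rewrite ler_wpM2r ?enorm_ge0.
Qed.

Lemma enorm_ge_near_identity B u e : frobenius (B - 1%:M) <= e ->
  (1 - e) * enorm u <= enorm (B *m u).
Proof.
move=> he; have := enormB_le (B *m u) ((B - 1%:M) *m u).
have -> : B *m u - (B - 1%:M) *m u = u.
  by rewrite mulmxBl mul1mx opprB subrKC.
have := enorm_mulmx (B - 1%:M) u.
have : frobenius (B - 1%:M) * enorm u <= e * enorm u.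
  by rewrite ler_wpM2r ?enorm_ge0.
lra.
Qed.

Lemma unitmx_near_identity B e : frobenius (B - 1%:M) <= e -> e < 1 ->
  B \in unitmx.
Proof.
move=> he e1; apply: injective_unitmx => u Bu0.
have := enorm_ge_near_identity u he; rewrite Bu0 enorm0 => h.
apply/eqP; rewrite -enorm_eq0 eq_le enorm_ge0 andbT.
by rewrite -(pmulr_rle0 _ (_ : 0 < 1 - e)) // subr_gt0.
Qed.

Section Curvature.
Variables (s y : 'cV[R]_d) (t : R).
Hypotheses (s0 : s != 0) (t_range : 0 <= t < 1)
  (ys : enorm (y - s) <= t * enorm s).

Lemma dot_curvature : (1 - t) * dot s s <= dot s y.
Proof.
have : `|dot s (y - s)| <= t * dot s s.
  apply: le_trans (cauchy_schwarz _ _) _.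
  have := ler_wpM2l (enorm_ge0 s) ys; rewrite -sqr_enorm; lra.
rewrite ler_norml dotBr => /andP[h1 h2]; lra.
Qed.

Lemma dot_ss_gt0 : 0 < dot s s.
Proof. by rewrite lt_def dot_eq0 s0 dot_ge0. Qed.

Lemma dot_sy_gt0 : 0 < dot s y.
Proof.
apply: lt_le_trans dot_curvature; rewrite mulr_gt0 ?dot_ss_gt0 //.
by case/andP: t_range => _; rewrite subr_gt0.
Qed.

(** With y = s + h, the numerators differ by h s^T + s h^T + h h^T, of size
    2 t + t^2 relative to |s|^2, and the denominators by s . h, of relative size
    t. *)
Lemma rank_one_perturbation :
  frobenius ((dot s y)^-1 *: (y *m y^T) - (dot s s)^-1 *: (s *m s^T))
    <= (3 + t) / (1 - t) * t.
Proof.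
have [t0 t1] := andP t_range.
have n0 := dot_ss_gt0; have c0 := dot_sy_gt0; have hc := dot_curvature.
have hs0 := ys; set h := y - s in hs0; have yE : y = s + h by rewrite subrKC.
have eE : (dot s y)^-1 *: (y *m y^T) - (dot s s)^-1 *: (s *m s^T)
   = (dot s y)^-1 *: (h *m s^T + s *m h^T + h *m h^T
        - (dot s h / dot s s) *: (s *m s^T)).
  have cE : dot s y = dot s s + dot s h by rewrite /h dotBr; ring.
  apply/matrixP => i j; rewrite !(outerE, mxE).
  have c1 := c0; rewrite cE in c1 *; by field; rewrite !gt_eqF.
rewrite eE frobeniusZ gtr0_norm ?invr_gt0 // mulrC ler_pdivrMr //.
apply: (@le_trans _ _ ((3 * t + t ^+ 2) * dot s s)); last first.
  have -> : (3 + t) / (1 - t) * t * dot s y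
     = (3 * t + t ^+ 2) * (dot s y / (1 - t)) by ring.
  rewrite ler_wpM2l ?ler_pdivlMr ?subr_gt0 ?[_ * (1 - t)]mulrC //.
  by rewrite addr_ge0 ?sqr_ge0 ?mulr_ge0.
rewrite -scaleNr.
apply: le_trans (frobeniusD _ _) _.
have e1 := frobeniusD (h *m s^T + s *m h^T) (h *m h^T).
have e2 := frobeniusD (h *m s^T) (s *m h^T).
rewrite frobeniusZ normrN !frobenius_outer in e1 e2 *.
have hs : enorm h * enorm s <= t * dot s s.
  by rewrite -sqr_enorm expr2 mulrA ler_wpM2r ?enorm_ge0.
have hh : enorm h * enorm h <= t ^+ 2 * dot s s.
  by rewrite -sqr_enorm -expr2 -exprMn ler_pXn2r ?nnegrE ?mulr_ge0 ?enorm_ge0.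
have h4 : `|dot s h / dot s s| * (enorm s * enorm s) <= t * dot s s.
  rewrite -expr2 sqr_enorm normrM normfV (gtr0_norm n0) divfK ?gt_eqF //.
  by apply: le_trans (cauchy_schwarz _ _) _; rewrite mulrC.
lra.
Qed.

End Curvature.

(** The congruences in the exact and in the actual DFP update both have this form, with
    z = s / |s|^2 and z = y / (s . y) respectively. *)
Lemma oblique_congruence B s z : B^T = B ->
  (1%:M - z *m s^T) *m B *m (1%:M - s *m z^T)
  = B - z *m (B *m s)^T - (B *m s) *m z^T + dot s (B *m s) *: (z *m z^T).
Proof.
move=> Bt; rewrite trmx_mul Bt mulmxBr mulmx1 !mulmxBl mul1mx !mulmxA.
rewrite -(mulmxA (z *m s^T) B s) mulmx_outer -scalemxAl opprB addrA.
by rewrite addrAC.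
Qed.

Lemma fdot_outer_l E u v : fdot (u *m v^T) E = dot u (E *m v).
Proof. by rewrite fdotC fdot_outer. Qed.

Definition fdotE := (fdotDl, fdotDr, fdotNl, fdotNr, fdotZl, fdotZr,
  fdot_outer, fdot_outer_l, mulmx_outer).

(** The matrix on the left is P E P for the orthogonal projection P along s.  Of the
    mass of E it loses the row and the column of s, and |E s|^2 / |s|^2 is the
    mass of one of them. *)
Lemma DFP_exact_decrease E s e p : E^T = E -> s != 0 ->
  e = E *m s -> p = (dot s s)^-1 *: s ->
  frobenius (E - p *m e^T - e *m p^T + dot s e *: (p *m p^T)) ^+ 2
    <= frobenius E ^+ 2 - dot e e / dot s s.
Proof.
move=> Et s0 eE pE; have n0 := dot_ss_gt0 s0.
have esE v : dot s (E *m v) = dot e v by rewrite dot_mulmxr Et eE.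
have Ep : E *m p = (dot s s)^-1 *: e by rewrite pE -scalemxAr eE.
have cs : dot s e ^+ 2 <= dot s s * dot e e.
  exact: (form_cauchy_schwarz (@dotDl R d) (@dotZl R d) (@dotC R d) (@dot_ge0 R d)).
rewrite !sqr_frobenius !fdotE Ep.
rewrite pE !(dotZl, dotZr, esE) (dotC e s).
have h : dot s e ^+ 2 / dot s s ^+ 2 <= dot e e / dot s s.
  rewrite ler_pdivrMr ?exprn_gt0 //; apply: le_trans cs _.
  by apply: le_of_eq; field; rewrite gt_eqF.
have -> : dot e e / dot s s = 2 * (dot e e / dot s s) - dot e e / dot s s by ring.
apply: (@le_trans _ _ (fdot E E - (2 * (dot e e / dot s s)
  - dot s e ^+ 2 / dot s s ^+ 2))); last by lra.
by apply: le_of_eq; field; rewrite gt_eqF.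
Qed.

(** An exact computation leaves
    (s . B e)^2 / (s . B s)^2 - 2 (e . B e) / (s . B s) as the change of the
    squared norm; Cauchy-Schwarz for the form of B bounds the first term by half
    of the second. *)
Lemma BFGS_exact_decrease B s e : B^T = B -> s != 0 ->
  (forall u, 0 <= dot u (B *m u)) -> 0 < dot s (B *m s) ->
  e = (B - 1%:M) *m s ->
  frobenius (B - (dot s (B *m s))^-1 *: (B *m s *m (B *m s)^T)
     + (dot s s)^-1 *: (s *m s^T) - 1%:M) ^+ 2
    <= frobenius (B - 1%:M) ^+ 2 - dot e (B *m e) / dot s (B *m s).
Proof.
move=> Bt s0 Bpos al0; have n0 := dot_ss_gt0 s0.
set E := B - 1%:M => eE; have Et : E^T = E by rewrite linearB /= Bt trmx1.
have BE u : B *m u = u + E *m u by rewrite mulmxBl mul1mx subrKC.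
have esE v : dot s (E *m v) = dot e v by rewrite dot_mulmxr Et eE.
have BC u v : dot u (B *m v) = dot v (B *m u) by rewrite dot_mulmxr Bt dotC.
have cs : dot s (B *m e) ^+ 2 <= dot s (B *m s) * dot e (B *m e).
  apply: (form_cauchy_schwarz (q := fun u v => dot u (B *m v))) => //.
  - by move=> u v w; rewrite dotDl.
  - by move=> a u v; rewrite dotZl.
rewrite [X in frobenius X](_ : _ = E
  - (dot s (B *m s))^-1 *: (B *m s *m (B *m s)^T)
  + (dot s s)^-1 *: (s *m s^T)); last first.
  by rewrite addrAC (addrAC B).
clearbody E; rewrite !sqr_frobenius !fdotE -!scalemxAl !mulmx_outer.
move: al0 cs; rewrite !BE -eE !(mulmxDr, dotDl, dotDr, dotZr) !esE -eE.
rewrite (dotC e s).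
set n := dot s s in n0 *; set a := dot s e; set b := dot e e.
set c := dot e (E *m e); set F := fdot E E => al0 cs.
have al1 : n + a != 0 by rewrite gt_eqF.
have h : (a + b) ^+ 2 / (n + a) ^+ 2 <= (b + c) / (n + a).
  rewrite ler_pdivrMr ?exprn_gt0 //; apply: le_trans cs _.
  by apply: le_of_eq; field.
apply: (@le_trans _ _ (F - (2 * ((b + c) / (n + a)) - (a + b) ^+ 2 / (n + a) ^+ 2)));
  last by lra.
by apply: le_of_eq; field; rewrite al1 gt_eqF.
Qed.

Lemma DFP_updateE B s y z b : B^T = B -> z = (dot s y)^-1 *: y -> b = B *m s ->
  DFP_update B s y = B - z *m b^T - b *m z^T + dot s b *: (z *m z^T)
    + (dot s y)^-1 *: (y *m y^T).
Proof.
move=> Bt zE bE; rewrite /DFP_update (dotC y s) scalemxAl scalemxAr -linearZ /= -zE.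
by rewrite oblique_congruence // -bE.
Qed.

Lemma DFP_update_sym B s y : B^T = B -> (DFP_update B s y)^T = DFP_update B s y.
Proof.
move=> Bt; rewrite (@DFP_updateE B s y _ _ Bt erefl erefl).
apply/matrixP => i j; rewrite !(outerE, mxE) -{1}Bt mxE; ring.
Qed.

Lemma BFGS_updateE B s y b : B^T = B -> b = B *m s ->
  BFGS_update B s y
  = B - (dot s b)^-1 *: (b *m b^T) + (dot s y)^-1 *: (y *m y^T).
Proof. by move=> Bt ->; rewrite /BFGS_update trmx_mul Bt !mulmxA. Qed.

Lemma BFGS_update_sym B s y : B^T = B -> (BFGS_update B s y)^T = BFGS_update B s y.
Proof.
move=> Bt; rewrite (@BFGS_updateE B s y _ Bt erefl).
apply/matrixP => i j; rewrite !(outerE, mxE) -{1}Bt mxE; ring.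
Qed.

(** Separates the update for y = s, whose effect is known exactly, from terms
    that contain m = z - p and therefore are of the order of y - s.  The vector c is
    the projection of B s orthogonal to s. *)
Lemma DFP_secant_split B s y z p b c m : B^T = B -> s != 0 ->
  z = (dot s y)^-1 *: y -> p = (dot s s)^-1 *: s -> b = B *m s ->
  c = b - dot s b *: p -> m = z - p ->
  DFP_update B s y - 1%:M
  = ((B - 1%:M) - p *m (b - s)^T - (b - s) *m p^T + dot s (b - s) *: (p *m p^T))
    + (- 1) *: (m *m c^T) + (- 1) *: (c *m m^T) + dot s b *: (m *m m^T)
    + ((dot s y)^-1 *: (y *m y^T) - (dot s s)^-1 *: (s *m s^T)).
Proof.
move=> Bt s0 zE pE bE cE mE; have n0 := dot_ss_gt0 s0.
rewrite (DFP_updateE Bt zE bE) dotBr cE mE.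
apply/matrixP => i j; rewrite !(outerE, mxE) pE !mxE.
by move: (dot s y)^-1 => k; field; rewrite gt_eqF.
Qed.

(** The cross terms of the split are controlled by k = 2 t / (1 - t), which bounds
    |m| |s|; they add up to (1 + D) k (2 + k) = 4 (1 + D) t / (1 - t)^2. *)
Lemma DFP_update_bound B s y t D : B^T = B -> s != 0 -> 0 <= t < 1 ->
  enorm (y - s) <= t * enorm s -> 0 < D -> frobenius (B - 1%:M) <= D ->
  frobenius (DFP_update B s y - 1%:M)
   <= frobenius (B - 1%:M)
      - enorm ((B - 1%:M) *m s) ^+ 2 / dot s s / (2 * D)
      + (4 * (1 + D) / (1 - t) ^+ 2 + (3 + t) / (1 - t)) * t.
Proof.
move=> Bt s0 t_range ys D0 BD; have n0 := dot_ss_gt0 s0.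
have [t0 t1] := andP t_range.
have c0 := dot_sy_gt0 s0 t_range ys; have hc := dot_curvature ys.
set b := B *m s; set p := (dot s s)^-1 *: s.
set c := b - dot s b *: p; set m := (dot s y)^-1 *: y - p.
rewrite (@DFP_secant_split B s y ((dot s y)^-1 *: y) p b c m) //.
have eE : b - s = (B - 1%:M) *m s by rewrite mulmxBl mul1mx.
have Et : (B - 1%:M)^T = B - 1%:M by rewrite linearB /= Bt trmx1.
have ideal : frobenius ((B - 1%:M) - p *m (b - s)^T - (b - s) *m p^T
     + dot s (b - s) *: (p *m p^T))
   <= frobenius (B - 1%:M) - enorm ((B - 1%:M) *m s) ^+ 2 / dot s s / (2 * D).
  apply: le_sub_of_sqr_le => //; first by rewrite frobenius_ge0.
    by rewrite divr_ge0 ?sqr_ge0 ?ltW.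
  by rewrite sqr_enorm; rewrite eE; apply: DFP_exact_decrease.
have rank1 := rank_one_perturbation s0 t_range ys.
have hb : enorm b <= (1 + D) * enorm s by apply: enorm_near_identity.
have hcb : enorm c <= enorm b.
  rewrite -(ler_pXn2r (n := 2)) ?nnegrE ?enorm_ge0 // !sqr_enorm.
  rewrite /c /p !(dotBl, dotBr, dotZl, dotZr) (dotC b s).
  have : 0 <= dot s b ^+ 2 / dot s s by rewrite divr_ge0 ?sqr_ge0 ?ltW.
  suff -> : dot b b - dot s b * ((dot s s)^-1 * dot s b) -
    (dot s b * ((dot s s)^-1 * dot s b) -
     dot s b * ((dot s s)^-1 * (dot s b * ((dot s s)^-1 * dot s s))))
    = dot b b - dot s b ^+ 2 / dot s s by lra.
  by field; rewrite gt_eqF.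
pose k := 2 * t / (1 - t).
have k0 : 0 <= k by rewrite /k divr_ge0 ?mulr_ge0 // subr_ge0 ltW.
have hm : enorm m * enorm s <= k.
  have -> : m = (dot s y)^-1 *: ((y - s) - (dot s (y - s) / dot s s) *: s).
    rewrite /m /p; apply/matrixP => i j; rewrite !mxE dotBr.
    by field; rewrite !gt_eqF.
  rewrite enormZ gtr0_norm ?invr_gt0 // -mulrA mulrC ler_pdivrMr //.
  apply: (@le_trans _ _ (2 * t * dot s s)).
    have -> : 2 * t * dot s s = 2 * t * enorm s * enorm s.
      by rewrite -sqr_enorm; ring.
    rewrite ler_wpM2r ?enorm_ge0 //.
    apply: le_trans (enormB_le _ _) _.
    suff : enorm ((dot s (y - s) / dot s s) *: s) <= t * enorm s by lra.
    rewrite enormZ ler_wpM2r ?enorm_ge0 // normrM normfV (gtr0_norm n0).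
    rewrite ler_pdivrMr //; apply: le_trans (cauchy_schwarz _ _) _.
    rewrite -sqr_enorm mulrC expr2 mulrA ler_wpM2r ?enorm_ge0 //.
  have -> : k * dot s y = 2 * t * (dot s y / (1 - t)) by rewrite /k; ring.
  rewrite ler_wpM2l ?mulr_ge0 // ler_pdivlMr ?subr_gt0 //.
  by rewrite mulrC.
have hmc : enorm m * enorm c <= k * (1 + D).
  apply: (@le_trans _ _ (enorm m * ((1 + D) * enorm s))).
    by rewrite ler_wpM2l ?enorm_ge0 // (le_trans hcb).
  have -> : enorm m * ((1 + D) * enorm s) = enorm m * enorm s * (1 + D) by ring.
  by rewrite ler_wpM2r // addr_ge0 // ltW.
have hbm : `|dot s b| * (enorm m * enorm m) <= k ^+ 2 * (1 + D).
  apply: (@le_trans _ _ ((enorm m * enorm s) ^+ 2 * (1 + D))).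
    have -> : (enorm m * enorm s) ^+ 2 * (1 + D)
      = (enorm s * ((1 + D) * enorm s)) * (enorm m * enorm m) by ring.
    rewrite ler_wpM2r ?mulr_ge0 ?enorm_ge0 //.
    by apply: le_trans (cauchy_schwarz _ _) _; rewrite ler_wpM2l ?enorm_ge0.
  rewrite ler_wpM2r ?addr_ge0 ?(ltW D0) //.
  by rewrite ler_pXn2r ?nnegrE ?k0 ?mulr_ge0 ?enorm_ge0.
set X := B - 1%:M - _ - _ + _ in ideal *; set Y := (dot s y)^-1 *: _ - _ in rank1 *.
pose X3 := X + -1 *: (m *m c^T); pose X2 := X3 + -1 *: (c *m m^T).
have e1 := frobeniusD (X2 + dot s b *: (m *m m^T)) Y.
have e2 := frobeniusD X2 (dot s b *: (m *m m^T)).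
have e3 := frobeniusD X3 (-1 *: (c *m m^T)).
have e4 := frobeniusD X (-1 *: (m *m c^T)).
move: e1 e2 e3 e4; rewrite /X2 /X3 !frobeniusZ !frobenius_outer normrN1 !mul1r.
rewrite (mulrC (enorm c)) => e1 e2 e3 e4.
have -> : (4 * (1 + D) / (1 - t) ^+ 2 + (3 + t) / (1 - t)) * t
   = 2 * (k * (1 + D)) + k ^+ 2 * (1 + D) + (3 + t) / (1 - t) * t.
  by rewrite /k; field; rewrite subr_eq0 gt_eqF.
move: e1 e2 e3 e4 ideal rank1 hmc hbm; clear; lra.
Qed.

(** The decrease for y = s is measured in the form of B, which compares with the
    Euclidean one within the bounds 1 - D and 1 + D. *)
Lemma BFGS_update_bound B s y t D : B^T = B -> s != 0 -> 0 <= t < 1 ->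
  enorm (y - s) <= t * enorm s -> 0 < D < 1 -> frobenius (B - 1%:M) <= D ->
  frobenius (BFGS_update B s y - 1%:M)
   <= frobenius (B - 1%:M)
      - (1 - D) / (1 + D) * (enorm ((B - 1%:M) *m s) ^+ 2 / dot s s) / (2 * D)
      + (3 + t) / (1 - t) * t.
Proof.
move=> Bt s0 t_range ys /andP[D0 D1] BD; have n0 := dot_ss_gt0 s0.
have [al1 al2] := andP (form_near_identity s BD).
have al0 : 0 < dot s (B *m s).
  by apply: lt_le_trans al1; rewrite mulr_gt0 // subr_gt0.
have Bpos u : 0 <= dot u (B *m u).
  have /andP[h _] := form_near_identity u BD; apply: le_trans h.
  by rewrite mulr_ge0 ?dot_ge0 // subr_ge0 ltW.
set e := (B - 1%:M) *m s.
have [be1 _] := andP (form_near_identity e BD).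
have dec := BFGS_exact_decrease Bt s0 Bpos al0 (erefl e).
have -> : BFGS_update B s y - 1%:M =
  (B - (dot s (B *m s))^-1 *: (B *m s *m (B *m s)^T)
     + (dot s s)^-1 *: (s *m s^T) - 1%:M)
  + ((dot s y)^-1 *: (y *m y^T) - (dot s s)^-1 *: (s *m s^T)).
  rewrite (BFGS_updateE y Bt erefl); apply/matrixP => i j.
  by rewrite !(outerE, mxE); ring.
apply: le_trans (frobeniusD _ _) _; apply: lerD; last exact: rank_one_perturbation.
apply: le_sub_of_sqr_le => //; first by rewrite frobenius_ge0.
  by apply: mulr_ge0; apply: divr_ge0; rewrite ?sqr_ge0 ?dot_ge0 //; lra.
apply: le_trans dec _; rewrite lerD2l lerN2 sqr_enorm.
have D1p : 0 < 1 + D by rewrite addr_gt0.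
rewrite ler_pdivlMr //.
apply: le_trans be1.
have -> : (1 - D) / (1 + D) * (dot e e / dot s s) * dot s (B *m s)
  = (1 - D) * dot e e * (dot s (B *m s) / ((1 + D) * dot s s)).
  by field; rewrite !gt_eqF.
rewrite ler_piMr ?mulr_ge0 ?dot_ge0 ?subr_ge0 ?(ltW D1) //.
by rewrite ler_pdivrMr ?mulr_gt0 // mul1r.
Qed.

End UpdateEstimates.

(** * The recursion in normalized coordinates *)

Section SequenceBounds.
Variable R : realType.

Lemma geometric_sum_le (x : R) k : 0 <= x < 1 ->
  \sum_(i < k) x ^+ i <= (1 - x)^-1.
Proof.
move=> /andP[x0 x1]; have h : 0 < 1 - x by rewrite subr_gt0.
rewrite -[leRHS]mul1r ler_pdivlMr // mulrC.
have -> : (1 - x) * (\sum_(i < k) x ^+ i) = 1 - x ^+ k.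
  by rewrite -opprB mulNr -subrX1 opprB.
by rewrite gerBl exprn_ge0.
Qed.

Lemma sum_sqrt_le (q : nat -> R) k : (forall i, 0 <= q i) ->
  \sum_(i < k) Num.sqrt (q i) <= Num.sqrt (k%:R * \sum_(i < k) q i).
Proof.
move=> q0; pose u : 'cV[R]_k := \col_i 1.
pose v : 'cV[R]_k := \col_i Num.sqrt (q i).
have -> : \sum_(i < k) Num.sqrt (q i) = dot u v.
  by rewrite dotE; apply: eq_bigr => i _; rewrite !mxE mul1r.
apply: le_trans (ler_norm _) _; apply: le_trans (cauchy_schwarz _ _) _.
have -> : k%:R = dot u u :> R.
  rewrite dotE (eq_bigr (fun=> 1)) ?sumr_const ?card_ord // => i _.
  by rewrite !mxE mulr1.
have -> : \sum_(i < k) q i = dot v v.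
  by rewrite dotE; apply: eq_bigr => i _; rewrite !mxE -expr2 sqr_sqrtr.
by rewrite sqrtrM ?dot_ge0.
Qed.

Lemma prod_le_mean (a : nat -> R) k : (forall i, 0 <= a i) ->
  \prod_(i < k) a i <= ((\sum_(i < k) a i) / k%:R) ^+ k.
Proof.
move=> a0; have [] := @leif_AGM R 'I_k predT (fun i => a i); first by [].
by rewrite cardT size_enum_ord.
Qed.

End SequenceBounds.

(** Here r is the error of the iterate, g the gradient and y its increments, all in
    coordinates where the Hessian at the minimizer is the identity.  The update
    rule enters only through its effect on |B - I|. *)
Section Recursion.
Variables (R : realType) (d : nat) (r g y : nat -> 'cV[R]_d) (B : nat -> 'M[R]_d).
Variables (kappa eps delta rho W c K : R).
Local Notation s k := (r k.+1 - r k).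
Local Notation E k := (B k - 1%:M).
Local Notation D := (2 * delta).
Local Notation q k := (enorm (E k *m s k) ^+ 2 / dot (s k) (s k)).
Hypotheses (kappa0 : 0 <= kappa) (eps0 : 0 <= eps) (W0 : 0 <= W)
  (c0 : 0 < c) (K0 : 0 <= K) (cK : 1 <= c * K ^+ 2)
  (delta_range : 0 < delta < 1 / 2) (rho_range : 0 < rho < 1).
Hypothesis update_bound : forall k t, 0 <= t <= eps ->
  enorm (y k - s k) <= t * enorm (s k) -> frobenius (E k) <= D ->
  frobenius (E k.+1) <= frobenius (E k) - c * q k / (2 * D) + W * t.
Hypothesis newton : forall k, B k \in unitmx -> B k *m s k = - g k.
Hypothesis g_approx : forall k, enorm (g k - r k) <= kappa / 2 * enorm (r k) ^+ 2.
Hypothesis y_approx : forall k, enorm (y k - s k) <=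
  kappa * Num.max (enorm (r k)) (enorm (r k.+1)) * enorm (s k).
Hypothesis s_neq0 : forall k, s k != 0.
Hypothesis r0_close : kappa * enorm (r 0) <= eps.
Hypothesis B0_close : frobenius (E 0) <= delta.
Hypothesis eps_small : W * (eps / (1 - rho)) <= delta.
Hypothesis rho_large : eps / 2 + D <= (1 - D) * rho.

Let q_ge0 k : 0 <= q k.
Proof. by rewrite divr_ge0 ?sqr_ge0 ?dot_ge0. Qed.

(** The Newton equation gives B r' = E r + (r - g) for the next error r', and B
    expands norms by at least 1 - 2 delta. *)
Lemma linear_step k : enorm (r k) <= rho ^+ k * enorm (r 0) ->
  frobenius (E k) <= D ->
  enorm (r k.+1) <= rho * enorm (r k) /\ kappa * enorm (r k) <= eps * rho ^+ k.
Proof.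
move=> rk Ek.
have [d0 d1] := andP delta_range; have [rh0 rh1] := andP rho_range.
have kr : kappa * enorm (r k) <= eps * rho ^+ k.
  apply: le_trans (ler_wpM2l kappa0 rk) _.
  by rewrite mulrCA mulrC ler_wpM2r ?exprn_ge0 ?(ltW rh0).
split=> //.
have D1 : D < 1 by lra.
have Bu := unitmx_near_identity Ek D1.
have e : B k *m r k.+1 = E k *m r k + (r k - g k).
  have -> : r k.+1 = s k + r k by rewrite subrK.
  by rewrite mulmxDr newton // mulmxBl mul1mx addrC addrA subrK.
have h1 := enorm_ge_near_identity (r k.+1) Ek; rewrite e in h1.
have h2 := enormD (E k *m r k) (r k - g k).
have h3 := enorm_mulmx (E k) (r k).
have h4 := ler_wpM2r (enorm_ge0 (r k)) Ek.
have h5 := g_approx k; rewrite enormB in h5.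
have h6 : kappa / 2 * enorm (r k) ^+ 2 <= eps / 2 * enorm (r k).
  have -> : kappa / 2 * enorm (r k) ^+ 2
    = kappa * enorm (r k) / 2 * enorm (r k) by ring.
  rewrite ler_wpM2r ?enorm_ge0 // ler_wpM2r ?invr_ge0 //.
  by apply: le_trans kr _; rewrite ler_piMr // exprn_ile1 ?(ltW rh0) ?(ltW rh1).
have h7 := ler_wpM2r (enorm_ge0 (r k)) rho_large.
have h8 : (1 - D) * enorm (r k.+1) <= (1 - D) * (rho * enorm (r k)) by lra.
by move: h8; rewrite ler_pM2l // subr_gt0.
Qed.

Let D_gt0 : 0 < D. Proof. by rewrite mulr_gt0 //; case/andP: delta_range. Qed.

Let budget k : W * eps * (\sum_(i < k) rho ^+ i) <= delta.
Proof.
apply: le_trans eps_small; rewrite mulrA ler_wpM2l ?mulr_ge0 //.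
by apply: geometric_sum_le; case/andP: rho_range => /ltW -> ->.
Qed.

Let sum_q_ge0 k : 0 <= c / (2 * D) * (\sum_(i < k) q i).
Proof.
apply: mulr_ge0; last by apply: sumr_ge0 => i _; exact: q_ge0.
by rewrite divr_ge0 ?(ltW c0) // mulr_ge0 // ltW.
Qed.

(** The sum of the gains q is carried along with |E|, so that one telescoping
    argument yields both |E| <= 2 delta and the summability of the gains. *)
Lemma invariant k :
  enorm (r k) <= rho ^+ k * enorm (r 0) /\
  frobenius (E k) + c / (2 * D) * (\sum_(i < k) q i)
    <= delta + W * eps * \sum_(i < k) rho ^+ i.
Proof.
have [rh0 rh1] := andP rho_range.
elim: k => [|k [rk Ik]].
  by rewrite !big_ord0 !mulr0 !addr0 mul1r.
have Ek : frobenius (E k) <= D.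
  have := budget k; have := sum_q_ge0 k; lra.
have [rk1 kr] := linear_step rk Ek.
split; first by apply: le_trans rk1 _; rewrite exprS -mulrA ler_wpM2l // ltW.
have tr : 0 <= kappa * enorm (r k) <= eps.
  rewrite mulr_ge0 ?enorm_ge0 //; apply: le_trans kr _.
  by rewrite ler_piMr // exprn_ile1 ?(ltW rh0) ?(ltW rh1).
have max_r : Num.max (enorm (r k)) (enorm (r k.+1)) = enorm (r k).
  apply/max_idPl; apply: le_trans rk1 _.
  by rewrite ler_piMl ?enorm_ge0 // ltW.
have := y_approx k; rewrite max_r => yk.
have := update_bound tr yk Ek.
have := ler_wpM2l W0 kr.
rewrite !big_ord_recr /= => h1 h2.
have -> : c / (2 * D) * (\sum_(i < k) q i + q k)
   = c / (2 * D) * (\sum_(i < k) q i) + c * q k / (2 * D) by ring.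
rewrite (mulrDr (W * eps)); lra.
Qed.

Lemma near_identity k : frobenius (E k) <= D.
Proof.
have [_ Ik] := invariant k; have := budget k; have := sum_q_ge0 k; lra.
Qed.

Let ratio k := (1 + rho) * Num.sqrt (q k) + eps / 2 * rho ^+ k.

(** The Newton equation also reads r' = (r - g) - E s, and |s| <= (1 + rho) |r|. *)
Lemma superlinear_step k : enorm (r k.+1) <= ratio k * enorm (r k).
Proof.
have [rh0 rh1] := andP rho_range; have [d0 d1] := andP delta_range.
have [rk _] := invariant k; have Ek := near_identity k.
have [rk1 kr] := linear_step rk Ek.
have D1 : D < 1 by lra.
have Bu := unitmx_near_identity Ek D1.
have e : r k.+1 = (r k - g k) - E k *m s k.
  by rewrite mulmxBl mul1mx newton // -opprD opprK addrA subrK subrKC.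
have h1 := enormB_le (r k - g k) (E k *m s k); rewrite -e in h1.
have h2 := g_approx k; rewrite enormB in h2.
have h3 : enorm (E k *m s k) = Num.sqrt (q k) * enorm (s k).
  rewrite sqrtrM ?sqr_ge0 // sqrtr_sqr ger0_norm ?enorm_ge0 //.
  by rewrite sqrtrV ?dot_ge0 // divfK // enorm_eq0.
have h4 := enormB_le (r k.+1) (r k).
have h5 : enorm (s k) <= (1 + rho) * enorm (r k) by lra.
have h6 := ler_wpM2l (sqrtr_ge0 (q k)) h5.
have h7 := ler_wpM2r (enorm_ge0 (r k)) kr.
rewrite /ratio; rewrite h3 in h1; lra.
Qed.

Lemma prod_ratio k : enorm (r k) <= (\prod_(i < k) ratio i) * enorm (r 0).
Proof.
elim: k => [|k IH]; first by rewrite big_ord0 mul1r.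
apply: le_trans (superlinear_step k) _; rewrite big_ord_recr /= mulrC.
have ratio_ge0 : 0 <= ratio k.
  have [rh0 rh1] := andP rho_range.
  by rewrite addr_ge0 ?mulr_ge0 ?sqrtr_ge0 ?exprn_ge0 ?addr_ge0 // ltW.
by rewrite mulrAC ler_wpM2r.
Qed.

Lemma superlinear_rate k : (0 < k)%N ->
  enorm (r k) <= ((2 * Num.sqrt 2 * delta * (1 + rho) * K * Num.sqrt k%:R
      + eps / (2 * (1 - rho))) / k%:R) ^+ k * enorm (r 0).
Proof.
move=> k0; apply: le_trans (prod_ratio k) _; rewrite ler_wpM2r ?enorm_ge0 //.
have [rh0 rh1] := andP rho_range; have [d0 d1] := andP delta_range.
have ratio_ge0 i : 0 <= ratio i.
  by rewrite addr_ge0 ?mulr_ge0 ?sqrtr_ge0 ?exprn_ge0 ?addr_ge0 // ltW.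
apply: le_trans (prod_le_mean k ratio_ge0) _.
have sum_ge0 : 0 <= \sum_(i < k) ratio i by apply: sumr_ge0.
have sum_le : \sum_(i < k) ratio i <=
    2 * Num.sqrt 2 * delta * (1 + rho) * K * Num.sqrt k%:R + eps / (2 * (1 - rho)).
  rewrite big_split /= -!mulr_sumr; apply: lerD; last first.
    rewrite invfM mulrA ler_wpM2l ?divr_ge0 //.
    by apply: geometric_sum_le; rewrite rh1 ltW.
  have q_le : \sum_(i < k) q i <= 8 * delta ^+ 2 * K ^+ 2.
    have [_ Ik] := invariant k; have bk := budget k; have fk := frobenius_ge0 (E k).
    have h : c * (\sum_(i < k) q i) <= 8 * delta ^+ 2.
      have : c / (2 * D) * (\sum_(i < k) q i) <= D by lra.
      rewrite mulrAC ler_pdivrMr ?mulr_gt0 // => h; apply: le_trans h _.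
      by apply: le_of_eq; ring.
    have S0 : 0 <= \sum_(i < k) q i by apply: sumr_ge0 => i _; exact: q_ge0.
    have := ler_wpM2r S0 cK; rewrite mul1r => h2; apply: le_trans h2 _.
    by rewrite mulrAC ler_wpM2r ?sqr_ge0.
  have -> : 2 * Num.sqrt 2 * delta * (1 + rho) * K * Num.sqrt k%:R
     = (1 + rho) * (2 * Num.sqrt 2 * delta * K * Num.sqrt k%:R) by ring.
  rewrite ler_wpM2l ?addr_ge0 ?(ltW rh0) //.
  apply: le_trans (sum_sqrt_le _ q_ge0) _.
  rewrite -(ler_pXn2r (n := 2)) ?nnegrE ?mulr_ge0 ?sqrtr_ge0 ?(ltW d0) //.
  rewrite sqr_sqrtr; last by rewrite mulr_ge0 // sumr_ge0 // => i _; exact: q_ge0.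
  have -> : (2 * Num.sqrt 2 * delta * K * Num.sqrt k%:R) ^+ 2
     = k%:R * (8 * delta ^+ 2 * K ^+ 2).
    rewrite !exprMn !sqr_sqrtr //; ring.
  by rewrite ler_wpM2l.
have kR : 0 < k%:R :> R by rewrite ltr0n.
have sum_ge0' := le_trans sum_ge0 sum_le.
by apply: lerXn2r; rewrite ?nnegrE ?divr_ge0 // ler_wpM2r ?invr_ge0.
Qed.

End Recursion.

(** * Invariance under linear changes of variables *)

Section ChangeOfVariables.
Variables (R : realType) (d : nat) (T : 'M[R]_d).
Hypotheses (Tt : T^T = T) (Tu : T \in unitmx).
Implicit Types (B : 'M[R]_d) (s y u v : 'cV[R]_d).

Lemma dot_change u v : dot (T *m u) (invmx T *m v) = dot u v.
Proof. by rewrite dotC dot_mulmxr Tt mulKVmx // dotC. Qed.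

Lemma outer_change u v : (T *m u) *m (T *m v)^T = T *m (u *m v^T) *m T.
Proof. by rewrite trmx_mul Tt !mulmxA. Qed.

Lemma mulmx_change B s : (T *m B *m T) *m (invmx T *m s) = T *m (B *m s).
Proof. by rewrite -!mulmxA mulKVmx. Qed.

Lemma DFP_update_change B s y : B^T = B ->
  T *m DFP_update B s y *m T = DFP_update (T *m B *m T) (invmx T *m s) (T *m y).
Proof.
move=> Bt; have TBt : (T *m B *m T)^T = T *m B *m T.
  by rewrite !trmx_mul Tt Bt mulmxA.
rewrite (DFP_updateE Bt erefl erefl) (DFP_updateE TBt erefl erefl).
rewrite mulmx_change (dotC (invmx T *m s) (T *m y)).
rewrite (dotC (invmx T *m s) (T *m (B *m s))).
rewrite !dot_change (dotC y) (dotC _ s).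
rewrite [(dot s y)^-1 *: (T *m y)]scalemxAr !outer_change.
by rewrite !(mulmxDr, mulmxDl, mulmxN, mulNmx) -!scalemxAr -!scalemxAl.
Qed.

Lemma BFGS_update_change B s y : B^T = B ->
  T *m BFGS_update B s y *m T = BFGS_update (T *m B *m T) (invmx T *m s) (T *m y).
Proof.
move=> Bt; have TBt : (T *m B *m T)^T = T *m B *m T.
  by rewrite !trmx_mul Tt Bt mulmxA.
rewrite (BFGS_updateE y Bt erefl) (BFGS_updateE (T *m y) TBt erefl).
rewrite mulmx_change (dotC (invmx T *m s) (T *m y)).
rewrite (dotC (invmx T *m s) (T *m (B *m s))).
rewrite !dot_change (dotC y) (dotC _ s) !outer_change.
by rewrite !(mulmxDr, mulmxDl, mulmxN, mulNmx) -!scalemxAr -!scalemxAl.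
Qed.

End ChangeOfVariables.

(** Convergence is with respect to the max norm, which the Euclidean norm
    dominates. *)
Lemma cvg_of_enorm_geometric (R : realType) (d : nat) (x : nat -> 'cV[R]_d)
    (xs : 'cV[R]_d) (C rho : R) : 0 < rho < 1 ->
  (forall k, enorm (x k - xs) <= C * rho ^+ k) -> x k @[k --> \oo] --> xs.
Proof.
move=> /andP[rho0 rho1] h; apply/cvgrPdist_lt => e e0.
have /cvgrPdist_lt/(_ e e0) : (C * rho ^+ k) @[k --> \oo] --> (0 : R).
  rewrite -[X in _ --> X](mulr0 C); apply: cvgM; first exact: cvg_cst.
  by apply: cvg_expr; rewrite gtr0_norm.
apply: filterS => k; rewrite sub0r normrN => hk.
rewrite -normrN opprB; apply: le_lt_trans hk; apply: le_trans (ler_norm _).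
apply: le_trans (h k); rewrite -[leLHS]/(mx_norm (x k - xs)).
have [->|/mx_norm_neq0[[i j] ->]] := eqVneq (mx_norm (x k - xs)) 0.
  exact: enorm_ge0.
by rewrite ord1 entry_le_enorm.
Qed.

(** * Back to the original coordinates *)

Section QuasiNewtonRate.
Variables (R : realType) (d : nat) (f : 'cV[R]_d -> R).
Variables (mu M : R) (xs : 'cV[R]_d).
Hypotheses (f2 : twice_differentiable f) (mu_gt0 : 0 < mu)
  (f_strong : strongly_convex mu f) (xs_min : forall x, f xs <= f x)
  (M_ge0 : 0 <= M)
  (hess_lip : forall x,
     opnorm (hessian f x - hessian f xs) <= M * enorm (x - xs)).
Local Notation H := (hessian f xs).
Local Notation T := (sqrtmx (invmx H)).
Local Notation kappa := (M / (mu `^ (3 / 2))).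
Local Notation normalize v := (invmx T *m v).
Implicit Types v w x : 'cV[R]_d.

Let H_posdef : symmetric_posdef H.
Proof. exact: (hessian_posdef f2 xs_min M_ge0 hess_lip mu_gt0). Qed.

Let T_posdef : symmetric_posdef T.
Proof. by have [] := sqrtmxP (symmetric_posdef_inv H_posdef). Qed.

Let Tt : T^T = T. Proof. by case: T_posdef. Qed.

Let Tu : T \in unitmx. Proof. exact: symmetric_posdef_unit. Qed.

Let normalize_hessian v : normalize v = T *m (H *m v).
Proof.
have [_ TT] := sqrtmxP (symmetric_posdef_inv H_posdef).
have {1}-> : v = T *m T *m (H *m v).
  by rewrite TT (mulKmx (symmetric_posdef_unit H_posdef)).
by rewrite -(mulmxA T T) mulKmx.
Qed.

Let dot_normalize v : dot (normalize v) (normalize v) = dot v (H *m v).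
Proof. by rewrite {1}normalize_hessian dot_change // dotC. Qed.

Lemma enorm_sqrt_hessian v : enorm (sqrtmx H *m v) = enorm (normalize v).
Proof.
have [[St _] SS] := sqrtmxP H_posdef.
by rewrite /enorm dot_normalize dot_mulmxr St mulmxA SS dotC.
Qed.

Let sm := Num.sqrt mu.
Let sm_gt0 : 0 < sm. Proof. by rewrite sqrtr_gt0. Qed.

Lemma enorm_le_normalize v : enorm v <= enorm (normalize v) / sm.
Proof.
rewrite ler_pdivlMr // -(ler_pXn2r (n := 2)) ?nnegrE ?mulr_ge0 ?enorm_ge0
  ?(ltW sm_gt0) //.
rewrite exprMn !sqr_enorm sqr_sqrtr ?(ltW mu_gt0) // dot_normalize (mulrC _ mu).
exact: (hessian_strongly_convex f2 xs_min hess_lip v f_strong).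
Qed.

Let enorm_T w : enorm (T *m w) <= enorm w / sm.
Proof. by have := enorm_le_normalize (T *m w); rewrite mulKmx. Qed.

Let kappaE : kappa = M / sm ^+ 3.
Proof.
congr (M / _); have -> : 3 / 2 = 1 + 2^-1 :> R by field.
rewrite powRD; last by rewrite (gt_eqF mu_gt0) implybT.
rewrite powRr1 ?(ltW mu_gt0) // powR12_sqrt ?(ltW mu_gt0) //.
by rewrite -{1}(sqr_sqrtr (ltW mu_gt0)) -/sm; ring.
Qed.

Let kappa_ge0 : 0 <= kappa.
Proof. by rewrite divr_ge0 ?powR_ge0. Qed.

Lemma normalized_gradient v :
  enorm (T *m gradient f (xs + v) - normalize v)
    <= kappa / 2 * enorm (normalize v) ^+ 2.
Proof.
apply: enorm_le_dual => [|w].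
  by rewrite mulr_ge0 ?sqr_ge0 // mulr_ge0 // invr_ge0.
rewrite normalize_hessian -mulmxBr dot_mulmxr Tt -normalize_hessian.
apply: le_trans (ler_norm _) _.
apply: le_trans (gradient_at_minimizer f2 xs_min hess_lip _ _) _.
apply: (@le_trans _ _ (M / 2 * (enorm (normalize v) / sm) ^+ 2 * (enorm w / sm))).
  apply: ler_pM; rewrite ?mulr_ge0 ?invr_ge0 ?enorm_ge0 ?sqr_ge0 //.
  apply: ler_wpM2l; first by rewrite divr_ge0.
  by rewrite lerXn2r ?nnegrE ?divr_ge0 ?enorm_ge0 ?(ltW sm_gt0) ?enorm_le_normalize.
by rewrite kappaE le_eqVlt; apply/orP; left; apply/eqP; field; rewrite gt_eqF.
Qed.

Lemma normalized_increment x x' :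
  enorm (T *m (gradient f x' - gradient f x) - normalize (x' - x))
    <= kappa * Num.max (enorm (normalize (x - xs))) (enorm (normalize (x' - xs)))
       * enorm (normalize (x' - x)).
Proof.
set m := Num.max _ _.
have m0 : 0 <= m by rewrite le_max enorm_ge0.
apply: enorm_le_dual => [|w].
  by rewrite mulr_ge0 ?enorm_ge0 // mulr_ge0.
rewrite normalize_hessian -mulmxBr dot_mulmxr Tt -normalize_hessian.
apply: le_trans (ler_norm _) _.
have segment (s : R) : 0 <= s <= 1 -> enorm (x + s *: (x' - x) - xs) <= m / sm.
  move=> /andP[s0 s1]; have s1' : 0 <= 1 - s by rewrite subr_ge0.
  have -> : x + s *: (x' - x) - xs = (1 - s) *: (x - xs) + s *: (x' - xs).
    by apply/matrixP => i j; rewrite !mxE; ring.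
  apply: le_trans (enormD _ _) _; rewrite !enormZ !ger0_norm //.
  have hx : enorm (x - xs) <= m / sm.
    apply: le_trans (enorm_le_normalize _) _.
    by rewrite ler_wpM2r ?invr_ge0 ?(ltW sm_gt0) // le_max lexx.
  have hx' : enorm (x' - xs) <= m / sm.
    apply: le_trans (enorm_le_normalize _) _.
    by rewrite ler_wpM2r ?invr_ge0 ?(ltW sm_gt0) // le_max lexx orbT.
  have := ler_wpM2l s0 hx'; have := ler_wpM2l s1' hx.
  move: (m / sm) => K; lra.
have := gradient_increment f2 M_ge0 hess_lip (T *m w) segment.
rewrite subrKC => h; apply: le_trans h _.
apply: (@le_trans _ _ (M * (m / sm) * (enorm (normalize (x' - x)) / sm)
  * (enorm w / sm))).
  have c0 : 0 <= M * (m / sm) by rewrite mulr_ge0 ?divr_ge0 ?(ltW sm_gt0).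
  apply: ler_pM; rewrite ?enorm_ge0 ?(mulr_ge0 c0) ?enorm_ge0 //.
  by rewrite ler_wpM2l ?enorm_le_normalize.
by rewrite kappaE le_eqVlt; apply/orP; left; apply/eqP; field; rewrite gt_eqF.
Qed.

Lemma normalized_fun v :
  `|f (xs + v) - f xs - enorm (normalize v) ^+ 2 / 2|
    <= kappa * enorm (normalize v) / 6 * enorm (normalize v) ^+ 2.
Proof.
rewrite sqr_enorm dot_normalize.
apply: le_trans (fun_at_minimizer f2 xs_min hess_lip _) _.
rewrite -dot_normalize -sqr_enorm.
apply: (@le_trans _ _ (M / 6 * (enorm (normalize v) / sm) ^+ 3)).
  rewrite ler_wpM2l ?divr_ge0 //.
  by rewrite lerXn2r ?nnegrE ?divr_ge0 ?enorm_ge0 ?(ltW sm_gt0) ?enorm_le_normalize.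
by rewrite kappaE le_eqVlt; apply/orP; left; apply/eqP; field; rewrite gt_eqF.
Qed.

Variables (upd : 'M[R]_d -> 'cV[R]_d -> 'cV[R]_d -> 'M[R]_d).
Variables (x0 : 'cV[R]_d) (B0 : 'M[R]_d) (eps delta rho W c K : R).
Hypotheses (upd_sym : forall B s y, B^T = B -> (upd B s y)^T = upd B s y)
  (upd_change : forall Q B s y, Q^T = Q -> Q \in unitmx -> B^T = B ->
     Q *m upd B s y *m Q = upd (Q *m B *m Q) (invmx Q *m s) (Q *m y))
  (upd_bound : forall B s y t, B^T = B -> s != 0 -> 0 <= t <= eps ->
     enorm (y - s) <= t * enorm s -> frobenius (B - 1%:M) <= 2 * delta ->
     frobenius (upd B s y - 1%:M) <= frobenius (B - 1%:M)
       - c * (enorm ((B - 1%:M) *m s) ^+ 2 / dot s s) / (2 * (2 * delta)) + W * t).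
Hypotheses (W_ge0 : 0 <= W) (c_gt0 : 0 < c) (K_ge0 : 0 <= K)
  (cK : 1 <= c * K ^+ 2).
Hypotheses (eps_range : 0 < eps < 1 / 2) (delta_range : 0 < delta < 1 / 2)
  (rho_range : 0 < rho < 1) (B0_sym : B0^T = B0).
Hypotheses (x0_close : kappa * enorm (sqrtmx H *m (x0 - xs)) <= eps)
  (B0_close : frobenius (T *m (B0 - H) *m T) <= delta)
  (eps_small : W * (eps / (1 - rho)) <= delta)
  (rho_large : eps / 2 + 2 * delta <= (1 - 2 * delta) * rho).

Local Notation x := (quasi_newton_iterate upd f x0 B0).
Local Notation B k := (iter k (quasi_newton_step upd f) (x0, B0)).2.
Hypothesis x_moves : forall k, x k.+1 - x k != 0.

Let r k := normalize (x k - xs).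
Let rS k : r k.+1 - r k = normalize (x k.+1 - x k).
Proof. by rewrite -mulmxBr opprB addrA subrK. Qed.

Let B_sym k : (B k)^T = B k.
Proof. by elim: k => [//|k IH]; rewrite /= upd_sym. Qed.

Let Bhat k := T *m B k *m T.

Let BS k : Bhat k.+1
  = upd (Bhat k) (r k.+1 - r k) (T *m (gradient f (x k.+1) - gradient f (x k))).
Proof. by rewrite rS /Bhat -upd_change. Qed.

Let s_neq0 k : r k.+1 - r k != 0.
Proof.
rewrite rS; apply: contraNneq (x_moves k) => h.
by rewrite -(mulKVmx Tu (x k.+1 - x k)) h mulmx0.
Qed.

Let THT : T *m H *m T = 1%:M.
Proof.
have [_ TT] := sqrtmxP (symmetric_posdef_inv H_posdef).
have e : T *m (T *m H) = 1%:M.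
  by rewrite mulmxA TT mulVmx // symmetric_posdef_unit.
by rewrite mulmx1C.
Qed.

Let E0 : frobenius (Bhat 0 - 1%:M) <= delta.
Proof. by rewrite -THT -mulmxBl -mulmxBr. Qed.

Let update_bound k t : 0 <= t <= eps ->
  enorm (T *m (gradient f (x k.+1) - gradient f (x k)) - (r k.+1 - r k))
    <= t * enorm (r k.+1 - r k) ->
  frobenius (Bhat k - 1%:M) <= 2 * delta ->
  frobenius (Bhat k.+1 - 1%:M) <= frobenius (Bhat k - 1%:M)
    - c * (enorm ((Bhat k - 1%:M) *m (r k.+1 - r k)) ^+ 2
        / dot (r k.+1 - r k) (r k.+1 - r k)) / (2 * (2 * delta)) + W * t.
Proof.
move=> ht hy hB; rewrite BS; apply: upd_bound => //.
by rewrite /Bhat !trmx_mul Tt B_sym mulmxA.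
Qed.

Let newton k : Bhat k \in unitmx ->
  Bhat k *m (r k.+1 - r k) = - (T *m gradient f (x k)).
Proof.
rewrite rS mulmx_change // -mulmxN => Bu; congr (_ *m _).
have Bku : B k \in unitmx by move: Bu; rewrite !unitmx_mul Tu andbT.
have -> : x k.+1 - x k = - (invmx (B k) *m gradient f (x k)).
  by rewrite /quasi_newton_iterate /= addrAC subrr add0r.
by rewrite mulmxN mulKVmx.
Qed.

Let g_approx k : enorm (T *m gradient f (x k) - r k) <= kappa / 2 * enorm (r k) ^+ 2.
Proof. by have := normalized_gradient (x k - xs); rewrite subrKC. Qed.

Let y_approx k :
  enorm (T *m (gradient f (x k.+1) - gradient f (x k)) - (r k.+1 - r k))
   <= kappa * Num.max (enorm (r k)) (enorm (r k.+1)) * enorm (r k.+1 - r k).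
Proof. by rewrite rS; apply: normalized_increment. Qed.

Let r0_close : kappa * enorm (r 0) <= eps.
Proof. by rewrite -enorm_sqrt_hessian. Qed.

Let eps_ge0 : 0 <= eps. Proof. by case/andP: eps_range => /ltW. Qed.

Let r_linear k : enorm (r k) <= rho ^+ k * enorm (r 0).
Proof.
exact: (proj1 (invariant kappa_ge0 eps_ge0 W_ge0 c_gt0 delta_range rho_range
  update_bound newton g_approx y_approx r0_close E0 eps_small rho_large k)).
Qed.

Lemma quasi_newton_cvg : x k @[k --> \oo] --> xs.
Proof.
apply: (@cvg_of_enorm_geometric _ _ _ _ (enorm (r 0) / sm) rho) => // k.
apply: le_trans (enorm_le_normalize _) _.
have -> : enorm (r 0) / sm * rho ^+ k = rho ^+ k * enorm (r 0) / sm by ring.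
by rewrite ler_wpM2r ?invr_ge0 ?(ltW sm_gt0) // r_linear.
Qed.

Local Notation rate k := (
  (2 * Num.sqrt 2 * delta * (1 + rho) * (1 + eps / 2) * K * Num.sqrt k%:R
   + (1 + rho) * (1 + eps / 2) * eps / (2 * (1 - rho))) / k%:R).

Let r_superlinear k : (0 < k)%N -> enorm (r k) <= rate k ^+ k * enorm (r 0).
Proof.
move=> k0; have [rh0 rh1] := andP rho_range; have [d0 d1] := andP delta_range.
have [e0 e1] := andP eps_range.
apply: le_trans (superlinear_rate kappa_ge0 eps_ge0 W_ge0 c_gt0 K_ge0 cK
  delta_range rho_range update_bound newton g_approx y_approx s_neq0 r0_close E0
  eps_small rho_large k0) _.
rewrite ler_wpM2r ?enorm_ge0 //.
have A0 : 0 <= 2 * Num.sqrt 2 * delta * (1 + rho) * K * Num.sqrt k%:R.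
  by rewrite !mulr_ge0 ?sqrtr_ge0 ?(ltW d0) // addr_ge0 // ltW.
have G0 : 0 <= eps / (2 * (1 - rho)).
  by rewrite divr_ge0 ?mulr_ge0 // subr_ge0 ltW.
have a1 : 1 <= 1 + eps / 2 by lra.
have a2 : 1 <= (1 + rho) * (1 + eps / 2) by nra.
have le_rate : (2 * Num.sqrt 2 * delta * (1 + rho) * K * Num.sqrt k%:R
      + eps / (2 * (1 - rho))) / k%:R <= rate k.
  rewrite ler_wpM2r ?invr_ge0 //; apply: lerD.
    have := ler_wpM2l A0 a1; rewrite mulr1 => h; apply: le_trans h _.
    by apply: le_of_eq; ring.
  have := ler_wpM2l G0 a2; rewrite mulr1 => h; apply: le_trans h _.
  by apply: le_of_eq; ring.
have l0 : 0 <= (2 * Num.sqrt 2 * delta * (1 + rho) * K * Num.sqrt k%:R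
      + eps / (2 * (1 - rho))) / k%:R by rewrite divr_ge0 ?addr_ge0.
by rewrite lerXn2r ?nnegrE // (le_trans l0 le_rate).
Qed.

Lemma quasi_newton_iterate_rate k : (1 <= k)%N ->
  enorm (sqrtmx H *m (x k - xs)) / enorm (sqrtmx H *m (x0 - xs)) <= rate k ^+ k.
Proof.
move=> k0; have [rh0 rh1] := andP rho_range; have [d0 d1] := andP delta_range.
have [e0 e1] := andP eps_range.
have rate0 : 0 <= rate k.
  rewrite divr_ge0 // addr_ge0 ?divr_ge0 ?mulr_ge0 ?sqrtr_ge0 //; lra.
rewrite !enorm_sqrt_hessian -/(r k) -/(r 0).
have [->|nz] := eqVneq (enorm (r 0)) 0.
  by rewrite invr0 mulr0 exprn_ge0.
by rewrite ler_pdivrMr ?r_superlinear // lt_def nz enorm_ge0.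
Qed.

Lemma quasi_newton_value_rate k : (1 <= k)%N ->
  (f (x k) - f xs) / (f x0 - f xs) <= (1 + eps / 2) ^+ 2 * rate k ^+ (2 * k).
Proof.
move=> k0; have [rh0 rh1] := andP rho_range.
have [e0 e1] := andP eps_range.
have := xs_min x0; rewrite -subr_ge0 le_eqVlt => /predU1P[<-|f0].
  by rewrite invr0 mulr0 mulr_ge0 ?sqr_ge0 // mulnC exprM sqr_ge0.
rewrite ler_pdivrMr //.
have close i : kappa * enorm (r i) <= eps.
  apply: le_trans r0_close; rewrite ler_wpM2l //.
  apply: le_trans (r_linear i) _.
  by rewrite ler_piMl ?enorm_ge0 ?exprn_ile1 ?(ltW rh0) ?(ltW rh1).
have taylor i :
    `|f (x i) - f xs - enorm (r i) ^+ 2 / 2| <= eps / 6 * enorm (r i) ^+ 2.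
  have := normalized_fun (x i - xs); rewrite subrKC -/(r i) => h.
  apply: le_trans h _; rewrite ler_wpM2r ?sqr_ge0 //.
  by rewrite ler_wpM2r ?invr_ge0 // close.
have := taylor 0; have := taylor k; rewrite !ler_norml.
move=> /andP[_ upper] /andP[lower _]; rewrite [x 0]/= in lower.
have sq : enorm (r k) ^+ 2 <= rate k ^+ (2 * k) * enorm (r 0) ^+ 2.
  rewrite mulnC exprM -exprMn.
  have h := r_superlinear k0.
  by rewrite lerXn2r ?nnegrE ?enorm_ge0 // (le_trans (enorm_ge0 _) h).
have rate0 : 0 <= rate k ^+ (2 * k) by rewrite mulnC exprM sqr_ge0.
(* The errors of both expansions fit into one factor (1 + eps / 2)^2. *)
have h1 : (1 / 2 + eps / 6) <= (1 + eps / 2) ^+ 2 * (1 / 2 - eps / 6) by nra.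
apply: (@le_trans _ _ ((1 / 2 + eps / 6) * enorm (r k) ^+ 2)); first by lra.
have h2 : 0 <= 1 / 2 + eps / 6 by lra.
apply: le_trans (ler_wpM2l h2 sq) _.
have h3 : 0 <= rate k ^+ (2 * k) * enorm (r 0) ^+ 2 by rewrite mulr_ge0 ?sqr_ge0.
apply: le_trans (ler_wpM2r h3 h1) _.
have -> : (1 + eps / 2) ^+ 2 * (1 / 2 - eps / 6)
    * (rate k ^+ (2 * k) * enorm (r 0) ^+ 2)
  = (1 + eps / 2) ^+ 2 * rate k ^+ (2 * k) * ((1 / 2 - eps / 6) * enorm (r 0) ^+ 2).
  by ring.
rewrite ler_wpM2l ?mulr_ge0 ?sqr_ge0 //; lra.
Qed.

(** The two methods enter only through the constants of their update bound: W, the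
    price of the curvature error, and c, the gain; K bounds 1 / sqrt c. *)
Theorem quasi_newton_superlinear :
  x k @[k --> \oo] --> xs /\
  forall k : nat, (1 <= k)%N ->
    enorm (sqrtmx H *m (x k - xs)) / enorm (sqrtmx H *m (x0 - xs)) <= rate k ^+ k /\
    (f (x k) - f xs) / (f x0 - f xs) <= (1 + eps / 2) ^+ 2 * rate k ^+ (2 * k).
Proof.
split; first exact: quasi_newton_cvg.
move=> k k0; split; first exact: quasi_newton_iterate_rate.
exact: quasi_newton_value_rate.
Qed.

End QuasiNewtonRate.

Theorem corollary4p6 (R : realType) (d : nat) (f : 'cV[R]_d -> R)
    (mu L M : R) (xs x0 : 'cV[R]_d) (B0 : 'M[R]_d) (eps delta rho : R)
    (f_diff2 : twice_differentiable f)
    (mu_gt0 : 0 < mu) (f_strong : strongly_convex mu f)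
    (L_gt0 : 0 < L) (f_lip : gradient_lipschitz L f)
    (xs_min : forall x, f xs <= f x)
    (M_ge0 : 0 <= M)
    (hess_lip : forall x,
       opnorm (hessian f x - hessian f xs) <= M * enorm (x - xs))
    (eps_range : 0 < eps < 1 / 2) (delta_range : 0 < delta < 1 / 2)
    (rho_range : 0 < rho < 1)
    (B0_spd : symmetric_posdef B0)
    (x0_close : M / (mu `^ (3 / 2))
                * enorm (sqrtmx (hessian f xs) *m (x0 - xs)) <= eps)
    (B0_close : frobenius (sqrtmx (invmx (hessian f xs))
                           *m (B0 - hessian f xs)
                           *m sqrtmx (invmx (hessian f xs))) <= delta) :
  (* DFP *)
  ((4 * (2 * delta + 1) / (1 - eps) ^+ 2 + (3 + eps) / (1 - eps))
     * (eps / (1 - rho)) <= delta ->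
   eps / 2 + 2 * delta <= (1 - 2 * delta) * rho ->
   let x := DFP_iterate f x0 B0 in
   (forall k : nat, x k.+1 - x k != 0) ->
   (x k @[k --> \oo] --> xs) /\
   (forall k : nat, (1 <= k)%N ->
     let rate :=
       (2 * Num.sqrt 2 * delta * (1 + rho) * (1 + eps / 2) * Num.sqrt k%:R
        + (1 + rho) * (1 + eps / 2) * eps / (2 * (1 - rho))) / k%:R in
     enorm (sqrtmx (hessian f xs) *m (x k - xs))
       / enorm (sqrtmx (hessian f xs) *m (x0 - xs)) <= rate ^+ k /\
     (f (x k) - f xs) / (f x0 - f xs)
       <= (1 + eps / 2) ^+ 2 * rate ^+ (2 * k)))
  /\
  (* BFGS *)
  ((3 + eps) * eps / ((1 - eps) * (1 - rho)) <= delta ->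
   eps / 2 + 2 * delta <= (1 - 2 * delta) * rho ->
   let x := BFGS_iterate f x0 B0 in
   (forall k : nat, x k.+1 - x k != 0) ->
   (x k @[k --> \oo] --> xs) /\
   (forall k : nat, (1 <= k)%N ->
     let rate :=
       (2 * Num.sqrt 2 * delta * (1 + rho) * (1 + eps / 2)
          * Num.sqrt ((1 + 2 * delta) / (1 - 2 * delta)) * Num.sqrt k%:R
        + (1 + rho) * (1 + eps / 2) * eps / (2 * (1 - rho))) / k%:R in
     enorm (sqrtmx (hessian f xs) *m (x k - xs))
       / enorm (sqrtmx (hessian f xs) *m (x0 - xs)) <= rate ^+ k /\
     (f (x k) - f xs) / (f x0 - f xs)
       <= (1 + eps / 2) ^+ 2 * rate ^+ (2 * k))).
Proof.
have [eps0 eps1] := andP eps_range; have [d0 d1] := andP delta_range.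
have [rho0 rho1] := andP rho_range; have [B0_sym _] := B0_spd.
have D_range : 0 < 2 * delta < 1 by apply/andP; split; lra.
have t_range t : 0 <= t <= eps -> 0 <= t < 1.
  by move=> /andP[t0 t1]; rewrite t0 /=; lra.
split=> eps_small rho_large x x_moves.
  pose W := 4 * (2 * delta + 1) / (1 - eps) ^+ 2 + (3 + eps) / (1 - eps).
  have W0 : 0 <= W.
    by rewrite addr_ge0 ?divr_ge0 ?sqr_ge0 //; lra.
  have bound (B : 'M[R]_d) s y t : B^T = B -> s != 0 -> 0 <= t <= eps ->
      enorm (y - s) <= t * enorm s -> frobenius (B - 1%:M) <= 2 * delta ->
      frobenius (DFP_update B s y - 1%:M) <= frobenius (B - 1%:M)
       - 1 * (enorm ((B - 1%:M) *m s) ^+ 2 / dot s s) / (2 * (2 * delta)) + W * t.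
    move=> Bt s0 ht ys BD; have [t0 t1] := andP ht; rewrite mul1r.
    have [D0 _] := andP D_range.
    apply: le_trans (DFP_update_bound Bt s0 (t_range _ ht) ys D0 BD) _.
    rewrite lerD2l ler_wpM2r // /W (addrC 1); apply: lerD.
      rewrite ler_wpM2l ?mulr_ge0 ?addr_ge0 ?(ltW D0) //.
      rewrite lef_pV2 ?posrE ?exprn_gt0 ?subr_gt0 //; try lra.
      by rewrite lerXn2r ?nnegrE ?subr_ge0 //; lra.
    apply: ler_pM; rewrite ?addr_ge0 ?invr_ge0 ?subr_ge0 ?lerD2l //; try lra.
    by rewrite lef_pV2 ?posrE; lra.
  have c1 : 1 <= 1 * 1 ^+ 2 :> R by rewrite expr1n mulr1.
  have change (Q B : 'M[R]_d) s y : Q^T = Q -> Q \in unitmx -> B^T = B ->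
      Q *m DFP_update B s y *m Q
      = DFP_update (Q *m B *m Q) (invmx Q *m s) (Q *m y).
    by move=> Qt Qu; exact: DFP_update_change.
  have [cvg rates] := quasi_newton_superlinear f_diff2 mu_gt0 f_strong xs_min M_ge0
    hess_lip (@DFP_update_sym R d) change bound W0 ltr01 ler01 c1 eps_range
    delta_range rho_range B0_sym x0_close B0_close eps_small rho_large x_moves.
  by split=> // k k0 rate; have := rates k k0; rewrite mulr1.
pose W := (3 + eps) / (1 - eps).
have W0 : 0 <= W by rewrite divr_ge0 //; lra.
have eps_small' : W * (eps / (1 - rho)) <= delta.
  apply: le_trans eps_small; apply: le_of_eq.
  by rewrite /W; field; apply/andP; split; lra.
pose c := (1 - 2 * delta) / (1 + 2 * delta).
pose K := Num.sqrt ((1 + 2 * delta) / (1 - 2 * delta)).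
have c0 : 0 < c by rewrite divr_gt0 //; lra.
have K0 : 0 <= K by apply: sqrtr_ge0.
have cK : 1 <= c * K ^+ 2.
  rewrite sqr_sqrtr; last by rewrite divr_ge0 //; lra.
  rewrite /c le_eqVlt; apply/orP; left; apply/eqP; field.
  by apply/andP; split; lra.
have bound (B : 'M[R]_d) s y t : B^T = B -> s != 0 -> 0 <= t <= eps ->
    enorm (y - s) <= t * enorm s -> frobenius (B - 1%:M) <= 2 * delta ->
    frobenius (BFGS_update B s y - 1%:M) <= frobenius (B - 1%:M)
     - c * (enorm ((B - 1%:M) *m s) ^+ 2 / dot s s) / (2 * (2 * delta)) + W * t.
  move=> Bt s0 ht ys BD; have [t0 t1] := andP ht.
  apply: le_trans (BFGS_update_bound Bt s0 (t_range _ ht) ys D_range BD) _.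
  rewrite lerD2l ler_wpM2r //.
  apply: ler_pM; rewrite ?addr_ge0 ?invr_ge0 ?subr_ge0 ?lerD2l //; try lra.
  by rewrite lef_pV2 ?posrE; lra.
have change (Q B : 'M[R]_d) s y : Q^T = Q -> Q \in unitmx -> B^T = B ->
    Q *m BFGS_update B s y *m Q
    = BFGS_update (Q *m B *m Q) (invmx Q *m s) (Q *m y).
  by move=> Qt Qu; exact: BFGS_update_change.
exact: (quasi_newton_superlinear f_diff2 mu_gt0 f_strong xs_min M_ge0
  hess_lip (@BFGS_update_sym R d) change bound W0 c0 K0 cK eps_range
  delta_range rho_range B0_sym x0_close B0_close eps_small' rho_large x_moves).
Qed.
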